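(* Let $\alpha\ge\beta\ge-\tfrac12$. Define $$P(x)=(1-x)\frac{p^{(\alpha+1,\beta)}_m(x)^2}{x^{(\alpha+1,\beta)}_{1,m}-x}\quad(m\ge1),\qquad Q(x)=(1-x^2)\frac{p^{(\alpha+1,\beta+1)}_{m-1}(x)^2}{x^{(\alpha+1,\beta+1)}_{1,m-1}-x}\quad(m\ge2),$$ where $x^{(a,b)}_{1,n}$ denotes the largest zero of $p^{(a,b)}_n$. Then $P$ and $Q$ are locally $s$-optimal in $\mathcal B^0_s(I;\alpha,\beta)$ for each $s\in\{+1,-1\}$.
   Context: $I=[-1,1]$; $w_{\alpha,\beta}(x)=c_{\alpha,\beta}(1-x)^\alpha(1+x)^\beta$ on $I$ normalized to a probability density; $P^{(\alpha,\beta)}_n$ Jacobi polynomials (orthogonal for $w_{\alpha,\beta}$, $P^{(\alpha,\beta)}_n(1)=\binom{n+\alpha}{n}$), $p^{(\alpha,\beta)}_n$ their $L^2(w_{\alpha,\beta})$-normalizations; $\widehat f(n)=\int_I f\,p^{(\alpha,\beta)}_nw_{\alpha,\beta}dx$. $\mathcal B_s(I;\alpha,\beta)$: continuous real $f$ on $I$ with $\widehat f(0)\le0$, $\{s\widehat f(n)\}$ eventually nonnegative, $sf(1)\le0$; $\mathcal B^0_s(I;\alpha,\beta)=\{f\in\mathcal B_s(I;\alpha,\beta): f(1)=0\}$. $r(f;I)=\inf\{r\in(0,2]: f\ge0\text{ on }[-1,1-r)\}$; $k(s\widehat f)=\min\{k\ge1:s\widehat f(n)\ge0\ \forall n\ge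 k\}$. A polynomial $f\in\mathcal B^0_s(I;\alpha,\beta)$ is locally $s$-optimal if there is $\delta>0$ such that $r(f;I)k(s\widehat f)^2<r(h;I)k(s\widehat h)^2$ for every polynomial $h\in\mathcal B^0_s(I;\alpha,\beta)$ with $\deg h\le\deg f$ and $0<\inf_{c>0}\|f-ch\|_{L^\infty(I)}<\delta$. *)

(* Defs.v *)
From Stdlib Require Import Reals Lra Classical ClassicalEpsilon Factorial.
Open Scope R_scope.

Definition inI (x : R) : Prop := -1 <= x <= 1.

Definition jw (a b x : R) : R := Rpower (1 - x) a * Rpower (1 + x) b.

Definition is_wint (a b : R) (g : R -> R) (l : R) : Prop :=
  forall eps, 0 < eps -> exists delta, 0 < delta /\
    forall u v, -1 < u < -1 + delta -> 1 - delta < v < 1 ->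
      exists pr : Riemann_integrable (fun x => g x * jw a b x) u v,
        Rabs (RiemannInt pr - l) < eps.

Definition wint (a b : R) (g : R -> R) : R :=
  epsilon (inhabits 0) (fun l => is_wint a b g l).

Definition wmean (a b : R) (g : R -> R) : R :=
  wint a b g / wint a b (fun _ => 1).

Fixpoint gprod (r : R) (k : nat) : R :=
  match k with
  | O => 1
  | S k' => gprod r k' * (r - INR k')
  end.
Definition gbinom (r : R) (k : nat) : R := gprod r k / INR (Factorial.fact k).

(* Jacobi polynomial P_n^{(a,b)} (standard normalization, P_n(1) = binom(n+a,n)). *)
Definition jacobiP (a b : R) (n : nat) (x : R) : R :=
  sum_f_R0 (fun k => gbinom (INR n + a) (n - k) * gbinom (INR n + b) k
                      * ((x - 1) / 2) ^ k * ((x + 1) / 2) ^ (n - k)) n.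

Definition jacobi_p (a b : R) (n : nat) (x : R) : R :=
  jacobiP a b n x / sqrt (wmean a b (fun y => (jacobiP a b n y) ^ 2)).

Definition fhat (a b : R) (f : R -> R) (n : nat) : R :=
  wmean a b (fun x => f x * jacobi_p a b n x).

Definition poly_deg_le (f : R -> R) (d : nat) : Prop :=
  exists c : nat -> R, forall x, f x = sum_f_R0 (fun i => c i * x ^ i) d.
Definition is_poly (f : R -> R) : Prop := exists d, poly_deg_le f d.
Definition deg_le (h f : R -> R) : Prop :=
  forall d, poly_deg_le f d -> poly_deg_le h d.

Definition contI (f : R -> R) : Prop :=
  forall x, inI x -> forall eps, 0 < eps -> exists delta, 0 < delta /\
    forall y, inI y -> Rabs (y - x) < delta -> Rabs (f y - f x) < eps.

Definition Bs (s a b : R) (f : R -> R) : Prop :=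
  contI f /\ fhat a b f 0 <= 0 /\
  (exists N, forall n, (N <= n)%nat -> 0 <= s * fhat a b f n) /\
  s * f 1 <= 0.
Definition B0s (s a b : R) (f : R -> R) : Prop := Bs s a b f /\ f 1 = 0.

Definition is_glb (E : R -> Prop) (m : R) : Prop :=
  (forall x, E x -> m <= x) /\ (forall m', (forall x, E x -> m' <= x) -> m' <= m).
Definition Rinf (E : R -> Prop) : R := epsilon (inhabits 0) (fun m => is_glb E m).
Definition Rsup (E : R -> Prop) : R := epsilon (inhabits 0) (fun m => is_lub E m).

Definition rf (f : R -> R) : R :=
  Rinf (fun r => 0 < r <= 2 /\ forall x, -1 <= x < 1 - r -> 0 <= f x).

Definition kgood (s a b : R) (f : R -> R) (k : nat) : Prop :=
  (1 <= k)%nat /\ forall n, (k <= n)%nat -> 0 <= s * fhat a b f n.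
Definition kf (s a b : R) (f : R -> R) : nat :=
  epsilon (inhabits 0%nat)
    (fun k => kgood s a b f k /\ forall k', kgood s a b f k' -> (k <= k')%nat).

Definition supI (g : R -> R) : R := Rsup (fun y => exists x, inI x /\ y = Rabs (g x)).

Definition distray (f h : R -> R) : R :=
  Rinf (fun y => exists c, 0 < c /\ y = supI (fun x => f x - c * h x)).

Definition locally_opt (s a b : R) (f : R -> R) : Prop :=
  is_poly f /\ B0s s a b f /\
  exists delta, 0 < delta /\
    forall h, is_poly h -> B0s s a b h -> deg_le h f ->
      0 < distray f h < delta ->
      rf f * (INR (kf s a b f)) ^ 2 < rf h * (INR (kf s a b h)) ^ 2.

Definition largest_zero (a b : R) (n : nat) (x1 : R) : Prop :=
  jacobi_p a b n x1 = 0 /\ forall y, jacobi_p a b n y = 0 -> y <= x1.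

(* Main.v *)
Require Import Defs.
From Stdlib Require Import Reals Lra Lia Classical ClassicalEpsilon FunctionalExtensionality List Wf_nat.
From Coquelicot Require Import Coquelicot.
Open Scope R_scope.

(** Gauss-Radau quadrature with nodes at 1 and at the zeros of [p_m^(alpha+1,beta)] is exact up to
    degree [2m].  If [h(1) = 0], [deg h <= 2m], [fhat h 0 <= 0] and [h >= 0] on [[-1, x1)], then [h]
    vanishes at every node, doubly at the zeros other than [x1], so [h] is a multiple of [P].  Hence
    [rf h > rf P] for every admissible [h] not proportional to [P], whatever its distance to [P].
    Nearness is only needed for [kf h >= kf P]: a coefficient of the wrong sign keeps its sign under
    small perturbations.  [Q] is treated in the same way with Gauss-Lobatto quadrature. *)

(** * Improper integrals against the Jacobi weight *)

(** No quadrature is written as a sum with explicit weights. A zero of [h] at 1 gives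
    [h x = (1 - x) * g x], and the factor passes into the weight: Radau for the exponents alpha,
    beta becomes Gauss for alpha + 1, beta. Gauss enters only through its sign content: a polynomial
    of degree at most 2k + 1 that is nonnegative at the k + 1 nodes has a nonnegative integral, and
    vanishes at the nodes if the integral is not positive. [P] has mean zero because P / (1 - x) is,
    up to a constant factor, p_m times a polynomial of degree m - 1.

    Orthogonality is derived from the explicit sum for [jacobiP]. Its terms integrate to Beta
    integrals, whose ratios follow from one integration by parts, without the Gamma function; the
    integral against (1 + x)^l then becomes an n-th finite difference of a polynomial of degree l <
    n.

    [wint], [Rinf], [Rsup] and [kf] are choices, so each needs an existence proof before it has a
    value. For [wint] the bound -1/2 on the exponents makes the arcsine density, whose primitive is
    bounded, a majorant. *)

Lemma Rpower_pos (x y : R) : 0 < Rpower x y.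
Proof. apply exp_pos. Qed.

Lemma jw_pos (a b x : R) : 0 < jw a b x.
Proof. apply Rmult_lt_0_compat; apply Rpower_pos. Qed.

Lemma jw_continuous (a b x : R) : -1 < x < 1 -> continuous (jw a b) x.
Proof.
  intros Hx. apply (ex_derive_continuous (jw a b)).
  unfold jw, Rpower. auto_derive. repeat split; lra.
Qed.

Lemma jw_shiftl (a b x : R) : -1 < x < 1 -> jw (a + 1) b x = (1 - x) * jw a b x.
Proof. intros Hx. unfold jw. rewrite Rpower_plus, Rpower_1 by lra. ring. Qed.

Lemma jw_shiftr (a b x : R) : -1 < x < 1 -> jw a (b + 1) x = (1 + x) * jw a b x.
Proof. intros Hx. unfold jw. rewrite Rpower_plus, Rpower_1 by lra. ring. Qed.

(** Both 1 - x and 1 + x stay below 2, so raising an exponent costs at most a power of 2. With a = b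
    = -1/2 this bounds every admissible weight by a multiple of the arcsine density. *)
Lemma jw_mono (a b c d x : R) : -1 < x < 1 -> a <= c -> b <= d ->
  jw c d x <= Rpower 2 (c - a) * Rpower 2 (d - b) * jw a b x.
Proof.
  intros Hx Ha Hb. unfold jw.
  replace (Rpower (1 - x) c) with (Rpower (1 - x) (c - a) * Rpower (1 - x) a)
    by (rewrite <- Rpower_plus; f_equal; ring).
  replace (Rpower (1 + x) d) with (Rpower (1 + x) (d - b) * Rpower (1 + x) b)
    by (rewrite <- Rpower_plus; f_equal; ring).
  assert (H1 : Rpower (1 - x) (c - a) <= Rpower 2 (c - a)) by (apply Rle_Rpower_l; lra).
  assert (H2 : Rpower (1 + x) (d - b) <= Rpower 2 (d - b)) by (apply Rle_Rpower_l; lra).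
  pose proof (Rpower_pos (1 - x) a). pose proof (Rpower_pos (1 + x) b).
  pose proof (Rpower_pos (1 - x) (c - a)). pose proof (Rpower_pos (1 + x) (d - b)).
  assert (H5 : Rpower (1 - x) (c - a) * Rpower (1 + x) (d - b)
               <= Rpower 2 (c - a) * Rpower 2 (d - b)) by (apply Rmult_le_compat; lra).
  replace (Rpower (1 - x) (c - a) * Rpower (1 - x) a *
           (Rpower (1 + x) (d - b) * Rpower (1 + x) b))
    with (Rpower (1 - x) (c - a) * Rpower (1 + x) (d - b) * (Rpower (1 - x) a * Rpower (1 + x) b))
    by ring.
  apply Rmult_le_compat_r; [nra | exact H5].
Qed.

Lemma jw_half (x : R) : -1 < x < 1 -> jw (-1/2) (-1/2) x = / sqrt (1 - x ^ 2).
Proof.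
  intros Hx. unfold jw. rewrite Rpower_mult_distr by lra.
  replace ((1 - x) * (1 + x)) with (1 - x ^ 2) by ring.
  replace (-1/2) with (- / 2) by field.
  rewrite Rpower_Ropp, Rpower_sqrt; [reflexivity | nra].
Qed.

Lemma jw_half_primitive (x : R) : -1 < x < 1 -> is_derive asin x (jw (-1/2) (-1/2) x).
Proof.
  intros Hx. rewrite jw_half by exact Hx. apply is_derive_Reals.
  replace (/ sqrt (1 - x ^ 2)) with (derive_pt asin x (derivable_pt_asin x Hx)).
  - apply derive_pt_eq_1 with (derivable_pt_asin x Hx). reflexivity.
  - rewrite derive_pt_asin. replace (Rsqr x) with (x ^ 2) by (unfold Rsqr; ring).
    unfold Rdiv. ring.
Qed.

(** [RInt] is total in its bounds, whereas [RiemannInt] carries an integrability proof; truncated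
    integrals are handled in this form and converted when [is_wint] is introduced or eliminated. *)
Definition pint (a b : R) (g : R -> R) (u v : R) : R := RInt (fun x => g x * jw a b x) u v.

Lemma ex_pint (a b : R) (g : R -> R) (u v : R) : (forall x, continuous g x) ->
  -1 < u < 1 -> -1 < v < 1 -> ex_RInt (fun x => g x * jw a b x) u v.
Proof.
  intros Hg Hu Hv. apply (@ex_RInt_continuous R_CompleteNormedModule).
  intros z Hz. apply (continuous_mult g (jw a b)); [apply Hg|].
  apply jw_continuous. revert Hz. unfold Rmin, Rmax. destruct (Rle_dec u v); lra.
Qed.

Lemma is_wint_intro (a b : R) (g : R -> R) (l : R) : (forall x, continuous g x) ->
  (forall eps, 0 < eps -> exists delta, 0 < delta /\
    forall u v, -1 < u < -1 + delta -> 1 - delta < v < 1 -> Rabs (pint a b g u v - l) < eps) ->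
  is_wint a b g l.
Proof.
  intros Hg H eps He. destruct (H eps He) as [d [Hd H']].
  (* Capping at 1 gives u < 0 < v, hence both bounds lie in (-1, 1), where the weight is
     continuous. *)
  exists (Rmin d 1). split; [apply Rmin_pos; lra|].
  intros u v Hu Hv. pose proof (Rmin_l d 1). pose proof (Rmin_r d 1).
  assert (ex : ex_RInt (fun x => g x * jw a b x) u v) by (apply ex_pint; [exact Hg|lra|lra]).
  exists (ex_RInt_Reals_0 _ _ _ ex). rewrite <- RInt_Reals. apply H'; lra.
Qed.

(** Both limits are compared on one pair of bounds, as the value of [RiemannInt] does not depend on
    the proof it carries. Uniqueness is what makes the chosen number [wint] computable. *)
Lemma is_wint_unique (a b : R) (g : R -> R) (l l' : R) :
  is_wint a b g l -> is_wint a b g l' -> l = l'.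
Proof.
  intros H H'. destruct (Req_dec l l') as [E|E]; [exact E|exfalso].
  assert (He : 0 < Rabs (l - l') / 2) by (pose proof (Rabs_pos_lt (l - l')); lra).
  destruct (H _ He) as [d [Hd P]]. destruct (H' _ He) as [d' [Hd' P']].
  set (m := Rmin d d'). assert (0 < m) by (apply Rmin_pos; lra).
  pose proof (Rmin_l d d'). pose proof (Rmin_r d d'). fold m in H1, H2.
  destruct (P (-1 + m / 2) (1 - m / 2)) as [pr Q]; [lra|lra|].
  destruct (P' (-1 + m / 2) (1 - m / 2)) as [pr' Q']; [lra|lra|].
  rewrite (RiemannInt_P5 pr' pr) in Q'.
  assert (Rabs (l - l') <= Rabs (RiemannInt pr - l) + Rabs (RiemannInt pr - l')).
  { rewrite (Rabs_minus_sym _ l).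
    replace (l - l') with ((l - RiemannInt pr) + (RiemannInt pr - l')) by ring. apply Rabs_triang. }
  lra.
Qed.

Lemma wint_eq (a b : R) (g : R -> R) (l : R) : is_wint a b g l -> wint a b g = l.
Proof.
  intros H. apply (is_wint_unique a b g); [|exact H].
  unfold wint. apply epsilon_spec. exists l. exact H.
Qed.

Lemma is_wint_lin (a b : R) (f g : R -> R) (c lf lg : R) :
  is_wint a b f lf -> is_wint a b g lg -> is_wint a b (fun x => f x + c * g x) (lf + c * lg).
Proof.
  intros Hf Hg eps He.
  assert (Hc : 0 < 1 + Rabs c) by (pose proof (Rabs_pos c); lra).
  assert (He' : 0 < eps / (1 + Rabs c)) by (apply Rdiv_lt_0_compat; lra).
  destruct (Hf _ He') as [d [Hd P]]. destruct (Hg _ He') as [d' [Hd' P']].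
  exists (Rmin d d'). split; [apply Rmin_pos; lra|].
  intros u v Hu Hv. pose proof (Rmin_l d d'). pose proof (Rmin_r d d').
  destruct (P u v) as [pr Q]; [lra|lra|]. destruct (P' u v) as [pr' Q']; [lra|lra|].
  replace (fun x => (f x + c * g x) * jw a b x)
    with (fun x => f x * jw a b x + c * (g x * jw a b x))
    by (apply functional_extensionality; intro; ring).
  exists (RiemannInt_P10 c pr pr').
  rewrite (RiemannInt_P13 pr pr').
  replace (RiemannInt pr + c * RiemannInt pr' - (lf + c * lg))
    with ((RiemannInt pr - lf) + c * (RiemannInt pr' - lg)) by ring.
  eapply Rle_lt_trans; [apply Rabs_triang|]. rewrite Rabs_mult.
  replace eps with (eps / (1 + Rabs c) + Rabs c * (eps / (1 + Rabs c))) by (field; lra).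
  pose proof (Rabs_pos c). nra.
Qed.

(* The partial integrals increase to their supremum, which is finite because the weight is
   dominated by a multiple of the derivative of [asin]. *)
Lemma is_wint_exists_nonneg (a b : R) (g : R -> R) : -1/2 <= a -> -1/2 <= b ->
  (forall x, continuous g x) -> (exists M, forall x, -1 < x < 1 -> 0 <= g x <= M) ->
  exists l, is_wint a b g l /\ forall u v, -1 < u -> u <= v -> v < 1 -> pint a b g u v <= l.
Proof.
  intros Ha Hb Hg [M HM].
  set (K := Rpower 2 (a - -1/2) * Rpower 2 (b - -1/2)).
  assert (HK : 0 < K) by (apply Rmult_lt_0_compat; apply Rpower_pos).
  assert (HM0 : 0 <= M) by (pose proof (HM 0); lra).
  set (E := fun y => exists u v, -1 < u /\ u <= v /\ v < 1 /\ y = pint a b g u v).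
  destruct (completeness E) as [l [Hub Hlub]].
  - exists (M * K * PI). intros y [u [v [Hu [Huv [Hv ->]]]]].
    assert (HF : is_RInt (jw (-1/2) (-1/2)) u v (minus (asin v) (asin u))).
    { apply (is_RInt_derive asin); intros x Hx; rewrite Rmin_left, Rmax_right in Hx by lra.
      - apply jw_half_primitive. lra.
      - apply jw_continuous. lra. }
    apply (is_RInt_scal _ _ _ (M * K)) in HF.
    apply Rle_trans with (M * K * (asin v - asin u)).
    + change (M * K * (asin v - asin u)) with (scal (M * K) (minus (asin v) (asin u))).
      replace (scal (M * K) (minus (asin v) (asin u)))
        with (RInt (fun y => scal (M * K) (jw (-1/2) (-1/2) y)) u v)
        by (apply is_RInt_unique; exact HF).
      unfold pint. apply RInt_le; [exact Huv| | |].
      * apply ex_pint; [exact Hg|lra|lra].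
      * eexists. exact HF.
      * intros x Hx. assert (Hx' : -1 < x < 1) by lra.
        pose proof (HM x Hx'). pose proof (jw_mono (-1/2) (-1/2) a b x Hx' Ha Hb).
        pose proof (jw_pos (-1/2) (-1/2) x). pose proof (jw_pos a b x). fold K in H0.
        change (scal (M * K) (jw (-1 / 2) (-1 / 2) x)) with ((M * K) * jw (-1 / 2) (-1 / 2) x).
        rewrite Rmult_assoc. apply Rmult_le_compat; lra.
    + apply Rmult_le_compat_l; [apply Rmult_le_pos; lra|].
      pose proof (asin_bound v). pose proof (asin_bound u). lra.
  - exists (pint a b g 0 0), 0, 0. repeat split; lra.
  - exists l. split.
    2: { intros u v Hu Huv Hv. apply Hub. exists u, v. repeat split; lra. }
    apply is_wint_intro; [exact Hg|]. intros eps He.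
    assert (HE : exists y, E y /\ l - eps < y).
    { apply NNPP. intro N. assert (l <= l - eps); [|lra]. apply Hlub. intros y Hy.
      destruct (Rle_dec y (l - eps)) as [|n]; [assumption|]. exfalso. apply N. exists y.
      split; [exact Hy|lra]. }
    destruct HE as [y [[u0 [v0 [Hu0 [Huv0 [Hv0 ->]]]]] Hy]].
    exists (Rmin (1 + u0) (1 - v0)). split; [apply Rmin_pos; lra|].
    intros u v Hu Hv. pose proof (Rmin_l (1 + u0) (1 - v0)). pose proof (Rmin_r (1 + u0) (1 - v0)).
    assert (pint a b g u v <= l) by (apply Hub; exists u, v; repeat split; lra).
    assert (pint a b g u0 v0 <= pint a b g u v).
    { unfold pint.
      rewrite <- (RInt_Chasles (fun x => g x * jw a b x) u u0 v)
        by (apply ex_pint; auto; lra).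
      rewrite <- (RInt_Chasles (fun x => g x * jw a b x) u0 v0 v)
        by (apply ex_pint; auto; lra).
      change plus with Rplus.
      assert (P : forall s t, -1 < s -> s <= t -> t < 1 -> 0 <= RInt (fun x => g x * jw a b x) s t).
      { intros s t Hs Hst Ht. apply RInt_ge_0; [lra|apply ex_pint; auto; lra|].
        intros x Hx. pose proof (HM x). pose proof (jw_pos a b x). apply Rmult_le_pos; lra. }
      pose proof (P u u0). pose proof (P v0 v). lra. }
    apply Rabs_def1; lra.
Qed.

(** * Polynomial functions *)

Lemma poly_deg_le_0 (f : R -> R) : poly_deg_le f 0 <-> exists c, forall x, f x = c.
Proof.
  split.
  - intros [c H]. exists (c 0%nat). intros x. rewrite H. simpl. ring.
  - intros [c H]. exists (fun _ => c). intros x. rewrite H. simpl. ring.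
Qed.

(** Horner form, the shape in which inductions on the degree are run. *)
Lemma poly_deg_le_S (f : R -> R) (d : nat) : poly_deg_le f (S d) <->
  exists c g, poly_deg_le g d /\ forall x, f x = c + x * g x.
Proof.
  split.
  - intros [c H]. exists (c 0%nat), (fun x => sum_f_R0 (fun i => c (S i) * x ^ i) d).
    split; [exists (fun i => c (S i)); reflexivity|].
    intros x. rewrite H, decomp_sum by lia. simpl pred. rewrite scal_sum.
    f_equal; [simpl; ring|]. apply sum_eq. intros i _. simpl. ring.
  - intros [c [g [[e He] H]]]. exists (fun i => match i with O => c | S j => e j end).
    intros x. rewrite H, decomp_sum by lia. simpl pred. rewrite He, scal_sum.
    f_equal; [simpl; ring|]. apply sum_eq. intros i _. simpl. ring.
Qed.

Lemma poly_deg_le_ext (f g : R -> R) (d : nat) :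
  (forall x, f x = g x) -> poly_deg_le f d -> poly_deg_le g d.
Proof. intros H [c Hc]. exists c. intros x. rewrite <- H. apply Hc. Qed.

Lemma poly_deg_le_const (c : R) (d : nat) : poly_deg_le (fun _ => c) d.
Proof.
  revert c. induction d as [|d IH]; intros c.
  - apply poly_deg_le_0. exists c. reflexivity.
  - apply poly_deg_le_S. exists c, (fun _ => 0). split; [apply IH|]. intros. ring.
Qed.

Lemma poly_deg_le_Sd (f : R -> R) (d : nat) : poly_deg_le f d -> poly_deg_le f (S d).
Proof.
  revert f. induction d as [|d IH]; intros f H.
  - apply poly_deg_le_0 in H. destruct H as [c H].
    apply (poly_deg_le_ext (fun _ => c)); [auto|apply poly_deg_le_const].
  - apply poly_deg_le_S in H. destruct H as [c [g [Hg H]]].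
    apply poly_deg_le_S. exists c, g. split; [apply IH; exact Hg|exact H].
Qed.

Lemma poly_deg_le_weaken (f : R -> R) (d e : nat) :
  poly_deg_le f d -> (d <= e)%nat -> poly_deg_le f e.
Proof. intros H L. induction L; [exact H|apply poly_deg_le_Sd; exact IHL]. Qed.

Lemma poly_deg_le_plus (f g : R -> R) (d : nat) :
  poly_deg_le f d -> poly_deg_le g d -> poly_deg_le (fun x => f x + g x) d.
Proof.
  intros [c H] [e H']. exists (fun i => c i + e i). intros x. rewrite H, H', <- sum_plus.
  apply sum_eq. intros. ring.
Qed.

Lemma poly_deg_le_scal (k : R) (f : R -> R) (d : nat) :
  poly_deg_le f d -> poly_deg_le (fun x => k * f x) d.
Proof.
  intros [c H]. exists (fun i => c i * k). intros x. rewrite H, scal_sum.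
  apply sum_eq. intros. ring.
Qed.

Lemma poly_deg_le_mult (f g : R -> R) (d e : nat) :
  poly_deg_le f d -> poly_deg_le g e -> poly_deg_le (fun x => f x * g x) (d + e).
Proof.
  revert f. induction d as [|d IH]; intros f Hf Hg.
  - apply poly_deg_le_0 in Hf. destruct Hf as [c Hf].
    apply (poly_deg_le_ext (fun x => c * g x)); [intros; rewrite Hf; reflexivity|].
    apply poly_deg_le_scal. exact Hg.
  - apply poly_deg_le_S in Hf. destruct Hf as [c [f1 [Hf1 Hf]]].
    apply (poly_deg_le_ext (fun x => c * g x + (0 + x * (f1 x * g x))));
      [intros; rewrite Hf; ring|].
    apply poly_deg_le_plus.
    + apply poly_deg_le_scal. apply (poly_deg_le_weaken _ e); [exact Hg|lia].
    + simpl. apply poly_deg_le_S. exists 0, (fun x => f1 x * g x).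
      split; [apply IH; assumption|reflexivity].
Qed.

Lemma poly_deg_le_affine (p q : R) : poly_deg_le (fun x => p + q * x) 1.
Proof.
  apply poly_deg_le_S. exists p, (fun _ => q). split; [apply poly_deg_le_const|].
  intros. ring.
Qed.

Lemma poly_deg_le_pow (f : R -> R) (d n : nat) :
  poly_deg_le f d -> poly_deg_le (fun x => f x ^ n) (n * d).
Proof.
  intros H. induction n as [|n IH].
  - exact (poly_deg_le_const 1 0).
  - simpl. apply (poly_deg_le_mult f (fun x => f x ^ n)); assumption.
Qed.

Lemma poly_deg_le_sum (F : nat -> R -> R) (d n : nat) :
  (forall i, (i <= n)%nat -> poly_deg_le (F i) d) ->
  poly_deg_le (fun x => sum_f_R0 (fun i => F i x) n) d.
Proof.
  induction n as [|n IH]; intros H.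
  - apply H. lia.
  - simpl. apply poly_deg_le_plus; [apply IH; intros; apply H; lia|apply H; lia].
Qed.

Lemma poly_div_root (f : R -> R) (d : nat) (a : R) : poly_deg_le f (S d) ->
  exists q, poly_deg_le q d /\ forall x, f x = f a + (x - a) * q x.
Proof.
  revert f. induction d as [|d IH]; intros f Hf;
    apply poly_deg_le_S in Hf; destruct Hf as [c [f1 [Hf1 Hf]]].
  - pose proof Hf1 as Hc. apply poly_deg_le_0 in Hc. destruct Hc as [e He].
    exists f1. split; [exact Hf1|]. intros x. rewrite !Hf, !He. ring.
  - destruct (IH f1 Hf1) as [q [Hq H]].
    exists (fun x => f1 a + x * q x). split.
    + apply poly_deg_le_S. exists (f1 a), q. split; [exact Hq|reflexivity].
    + intros x. rewrite !Hf, (H x). ring.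
Qed.

Lemma poly_deg_le_continuous (f : R -> R) (d : nat) (x : R) : poly_deg_le f d -> continuous f x.
Proof.
  revert f. induction d as [|d IH]; intros f Hf.
  - apply poly_deg_le_0 in Hf. destruct Hf as [c Hf].
    apply (continuous_ext (fun _ => c)); [intros; symmetry; apply Hf|apply continuous_const].
  - apply poly_deg_le_S in Hf. destruct Hf as [c [f1 [Hf1 Hf]]].
    apply (continuous_ext (fun y : R => c + y * f1 y)); [intros; symmetry; apply Hf|].
    apply (continuous_plus (fun _ : R => c) (fun y : R => y * f1 y)); [apply continuous_const|].
    apply (continuous_mult (fun y : R => y) f1); [apply continuous_id|apply IH; exact Hf1].
Qed.

Lemma is_poly_continuous (f : R -> R) (x : R) : is_poly f -> continuous f x.
Proof. intros [d H]. apply (poly_deg_le_continuous f d x H). Qed.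

Lemma is_poly_ext (f g : R -> R) : (forall x, f x = g x) -> is_poly f -> is_poly g.
Proof. intros H [d Hd]. exists d. apply (poly_deg_le_ext f); assumption. Qed.

Lemma is_poly_const (c : R) : is_poly (fun _ => c).
Proof. exists 0%nat. apply poly_deg_le_const. Qed.

Lemma is_poly_scal (k : R) (f : R -> R) : is_poly f -> is_poly (fun x => k * f x).
Proof. intros [d H]. exists d. apply poly_deg_le_scal. exact H. Qed.

Lemma is_poly_plus (f g : R -> R) : is_poly f -> is_poly g -> is_poly (fun x => f x + g x).
Proof.
  intros [d H] [e H']. exists (d + e)%nat.
  apply poly_deg_le_plus; eapply poly_deg_le_weaken; eauto; lia.
Qed.

Lemma is_poly_lin (c : R) (f g : R -> R) :
  is_poly f -> is_poly g -> is_poly (fun x => f x + c * g x).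
Proof. intros. apply is_poly_plus; [|apply is_poly_scal]; assumption. Qed.

Lemma is_poly_mult (f g : R -> R) : is_poly f -> is_poly g -> is_poly (fun x => f x * g x).
Proof. intros [d H] [e H']. exists (d + e)%nat. apply poly_deg_le_mult; assumption. Qed.

Lemma is_poly_affine (p q : R) : is_poly (fun x => p + q * x).
Proof. exists 1%nat. apply poly_deg_le_affine. Qed.

Lemma is_poly_pow (f : R -> R) (n : nat) : is_poly f -> is_poly (fun x => f x ^ n).
Proof. intros [d H]. exists (n * d)%nat. apply poly_deg_le_pow. exact H. Qed.

Lemma continuous_neighbourhood (f : R -> R) (x : R) : continuous f x -> forall eps, 0 < eps ->
  exists delta, 0 < delta /\ forall y, Rabs (y - x) < delta -> Rabs (f y - f x) < eps.
Proof.
  intros H eps He. apply continuity_pt_filterlim in H.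
  destruct (H eps He) as [d [Hd P]]. exists d. split; [exact Hd|].
  intros y Hy. destruct (Req_dec x y) as [->|N].
  - rewrite Rminus_eq_0, Rabs_R0. exact He.
  - apply (P y). split; [split; [exact I|exact N]|exact Hy].
Qed.

Lemma continuous_eq_punctured (f : R -> R) (x d : R) : continuous f x -> 0 < d ->
  (forall y, Rabs (y - x) < d -> y <> x -> f y = 0) -> f x = 0.
Proof.
  intros Hc Hd H. apply NNPP. intro N. apply Rabs_pos_lt in N.
  destruct (continuous_neighbourhood f x Hc _ N) as [e [He P]].
  set (t := Rmin d e / 2). pose proof (Rmin_l d e). pose proof (Rmin_r d e).
  assert (0 < Rmin d e) by (apply Rmin_pos; lra).
  assert (E : Rabs (x + t - x) = t) by (rewrite Rabs_right; unfold t; lra).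
  specialize (P (x + t)). rewrite E in P.
  rewrite (H (x + t)) in P by (rewrite ?E; unfold t; lra).
  rewrite Rminus_0_l, Rabs_Ropp in P. unfold t in P. lra.
Qed.

(** Dividing by the root 0 leaves a quotient of lower degree that vanishes on the interval away from
    0, and at 0 by continuity. *)
Lemma poly_vanishing (f : R -> R) : is_poly f ->
  (forall x, -1 < x < 1 -> f x = 0) -> forall x, f x = 0.
Proof.
  intros [d Hd]. revert f Hd. induction d as [|d IH]; intros f Hf H.
  - apply poly_deg_le_0 in Hf. destruct Hf as [c Hf]. intros x.
    rewrite Hf, <- (Hf 0). apply H. lra.
  - destruct (poly_div_root f d 0 Hf) as [q [Hq E]].
    assert (F : forall x, -1 < x < 1 -> x <> 0 -> q x = 0).
    { intros x Hx N. pose proof (E x) as E'. rewrite (H x Hx), (H 0) in E' by lra.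
      apply (Rmult_eq_reg_l x); [lra|exact N]. }
    assert (Z : forall x, q x = 0).
    { apply IH; [exact Hq|]. intros x Hx. destruct (Req_dec x 0) as [->|N]; [|auto].
      apply (continuous_eq_punctured q 0 1); [|lra|].
      - apply (poly_deg_le_continuous q d). exact Hq.
      - intros y Hy Ny. apply F; [|exact Ny]. apply Rabs_def2 in Hy. lra. }
    intros x. rewrite E, Z, (H 0) by lra. ring.
Qed.

Lemma poly_nonzero_in_interval (f : R -> R) (x : R) : is_poly f -> f x <> 0 ->
  exists y, -1 < y < 1 /\ f y <> 0.
Proof.
  intros Hf N. apply NNPP. intro H. apply N. apply poly_vanishing; [exact Hf|].
  intros y Hy. apply NNPP. intro Ny. apply H. exists y. split; assumption.
Qed.

Definition lprod (l : list R) (x : R) : R := fold_right (fun z p => (x - z) * p) 1 l.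

Lemma lprod_deg (l : list R) : poly_deg_le (lprod l) (length l).
Proof.
  induction l as [|z l IH]; [apply poly_deg_le_const|].
  apply (poly_deg_le_ext (fun x => (- z + 1 * x) * lprod l x)); [intros; simpl; ring|].
  apply (poly_deg_le_mult _ _ 1 (length l)); [apply poly_deg_le_affine|exact IH].
Qed.

Lemma lprod_is_poly (l : list R) : is_poly (lprod l).
Proof. exists (length l). apply lprod_deg. Qed.

Lemma lprod_app_cons (l1 l2 : list R) (z x : R) :
  lprod (l1 ++ z :: l2) x = (x - z) * lprod (l1 ++ l2) x.
Proof. induction l1 as [|y l IH]; simpl; [reflexivity|]. rewrite IH. ring. Qed.

Lemma lprod_root (l : list R) (x : R) : lprod l x = 0 <-> In x l.
Proof.
  induction l as [|z l IH]; simpl; [split; [intros; lra|contradiction]|].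
  rewrite <- IH. split.
  - intros H. apply Rmult_integral in H. destruct H; [left; lra|right; assumption].
  - intros [->|H]; [ring|rewrite H; ring].
Qed.

(** Distinctness lets the remaining roots survive each division. With k = 0 the quotient is a
    constant, which determines [f] up to a factor. *)
Lemma poly_div_roots (l : list R) (k : nat) (f : R -> R) : NoDup l ->
  poly_deg_le f (k + length l) -> (forall z, In z l -> f z = 0) ->
  exists q, poly_deg_le q k /\ forall x, f x = lprod l x * q x.
Proof.
  revert f. induction l as [|z l IH]; intros f ND Hf H; simpl in Hf.
  - rewrite Nat.add_0_r in Hf. exists f. split; [exact Hf|]. intros. simpl. ring.
  - rewrite Nat.add_succ_r in Hf. destruct (poly_div_root f _ z Hf) as [f1 [Hf1 E]].
    inversion ND as [|? ? Nz ND']; subst.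
    destruct (IH f1 ND' Hf1) as [q [Hq E']].
    + intros y Hy. pose proof (E y) as Ey. rewrite (H y), (H z) in Ey by (simpl; auto).
      apply (Rmult_eq_reg_l (y - z)); [lra|]. intro. apply Nz. replace z with y by lra. exact Hy.
    + exists q. split; [exact Hq|]. intros x. rewrite E, E', (H z) by (simpl; auto). simpl. ring.
Qed.

(* Peel off a root at each sign change; a root met twice contributes a square to [r]. *)
Lemma poly_sign_changes (d : nat) (p : R -> R) : poly_deg_le p d ->
  exists l r k, NoDup l /\ (forall z, In z l -> -1 < z < 1) /\ (k + length l <= d)%nat /\
    poly_deg_le r k /\ (forall x, p x = lprod l x * r x) /\
    ((forall x, -1 < x < 1 -> 0 <= r x) \/ (forall x, -1 < x < 1 -> r x <= 0)).
Proof.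
  assert (Base : forall d p, poly_deg_le p d ->
    ((forall x, -1 < x < 1 -> 0 <= p x) \/ (forall x, -1 < x < 1 -> p x <= 0)) ->
    exists l r k, NoDup l /\ (forall z, In z l -> -1 < z < 1) /\ (k + length l <= d)%nat /\
    poly_deg_le r k /\ (forall x, p x = lprod l x * r x) /\
    ((forall x, -1 < x < 1 -> 0 <= r x) \/ (forall x, -1 < x < 1 -> r x <= 0))).
  { clear. intros d p Hp H. exists nil, p, d.
    split; [constructor|]. split; [intros z []|]. split; [simpl; lia|]. split; [exact Hp|].
    split; [intros; simpl; ring|exact H]. }
  revert p. induction d as [|d IH]; intros p Hp.
  - apply Base; [exact Hp|].
    apply poly_deg_le_0 in Hp. destruct Hp as [c Hp].
    destruct (Rle_dec 0 c); [left|right]; intros; rewrite Hp; lra.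
  - destruct (classic (forall x, -1 < x < 1 -> 0 <= p x)) as [A|A]; [apply Base; auto|].
    destruct (classic (forall x, -1 < x < 1 -> p x <= 0)) as [B|B]; [apply Base; auto|].
    apply not_all_ex_not in A. destruct A as [x A]. apply imply_to_and in A. destruct A as [Hx A].
    apply not_all_ex_not in B. destruct B as [y B]. apply imply_to_and in B. destruct B as [Hy B].
    assert (C : continuity p).
    { intros z. apply continuity_pt_filterlim. apply (poly_deg_le_continuous p (S d)). exact Hp. }
    assert (Z : exists z, -1 < z < 1 /\ p z = 0).
    { destruct (Rle_dec x y) as [L|L].
      - destruct (IVT_cor p x y C L) as [z [Hz E]]; [nra|]. exists z. split; [lra|exact E].
      - destruct (IVT_cor p y x C) as [z [Hz E]]; [lra|nra|]. exists z. split; [lra|exact E]. }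
    destruct Z as [z [Hz Pz]].
    destruct (poly_div_root p d z Hp) as [p1 [Hp1 E]].
    destruct (IH p1 Hp1) as [l [r [k [ND [Hl [Len [Hr [E1 Sg]]]]]]]].
    destruct (classic (In z l)) as [I|I].
    + apply in_split in I. destruct I as [l1 [l2 ->]].
      exists (l1 ++ l2), (fun x => (x - z) ^ 2 * r x), (2 + k)%nat.
      rewrite length_app in Len |- *. simpl in Len.
      split; [apply NoDup_remove_1 in ND; exact ND|].
      split; [intros t Ht; apply Hl; apply in_app_iff; apply in_app_iff in Ht; simpl; tauto|].
      split; [lia|]. split; [|split].
      * apply (poly_deg_le_mult (fun x => (x - z) ^ 2) r 2 k); [|exact Hr].
        apply (poly_deg_le_ext (fun x => (- z + 1 * x) ^ 2)); [intros; ring|].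
        apply (poly_deg_le_pow _ 1 2). apply poly_deg_le_affine.
      * intros t. rewrite E, E1, Pz, lprod_app_cons. ring.
      * destruct Sg as [Sg|Sg]; [left|right]; intros t Ht; specialize (Sg t Ht);
          pose proof (pow2_ge_0 (t - z)); nra.
    + exists (z :: l), r, k.
      split; [constructor; assumption|].
      split; [intros t [<-|Ht]; auto|]. split; [simpl; lia|]. split; [exact Hr|].
      split; [|exact Sg]. intros t. rewrite E, E1, Pz. simpl. ring.
Qed.

(** * Integration of polynomials *)

Lemma poly_bounded (g : R -> R) : is_poly g ->
  exists M, 0 < M /\ forall x, -1 <= x <= 1 -> Rabs (g x) <= M.
Proof.
  intros Hg.
  assert (C : forall c, -1 <= c <= 1 -> continuity_pt (fun x => Rabs (g x)) c).
  { intros c _. apply continuity_pt_filterlim.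
    apply (continuous_comp g Rabs); [apply is_poly_continuous; exact Hg|apply continuous_Rabs]. }
  destruct (continuity_ab_maj (fun x => Rabs (g x)) (-1) 1) as [m [Hm _]]; [lra|exact C|].
  exists (Rabs (g m) + 1). pose proof (Rabs_pos (g m)). split; [lra|].
  intros x Hx. pose proof (Hm x Hx). lra.
Qed.

Lemma is_wint_elim (a b : R) (g : R -> R) (l : R) : is_wint a b g l ->
  forall eps, 0 < eps -> exists delta, 0 < delta /\
    forall u v, -1 < u < -1 + delta -> 1 - delta < v < 1 -> Rabs (pint a b g u v - l) < eps.
Proof.
  intros H eps He. destruct (H eps He) as [d [Hd P]]. exists d. split; [exact Hd|].
  intros u v Hu Hv. destruct (P u v Hu Hv) as [pr Q]. unfold pint.
  rewrite (RInt_Reals _ _ _ pr). exact Q.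
Qed.

(** Truncated integrals never reach the endpoints, so agreement of the integrands on the open
    interval suffices. This matters because the identities that shift an exponent of [jw] are
    available only there. *)
Lemma is_wint_transfer (a b a' b' : R) (f g : R -> R) (l : R) : (forall x, continuous g x) ->
  (forall x, -1 < x < 1 -> f x * jw a b x = g x * jw a' b' x) ->
  is_wint a b f l -> is_wint a' b' g l.
Proof.
  intros Hg E H. apply is_wint_intro; [exact Hg|]. intros eps He.
  destruct (is_wint_elim _ _ _ _ H eps He) as [d [Hd P]].
  exists (Rmin d 1). split; [apply Rmin_pos; lra|].
  intros u v Hu Hv. pose proof (Rmin_l d 1). pose proof (Rmin_r d 1).
  replace (pint a' b' g u v) with (pint a b f u v); [apply P; lra|].
  unfold pint. apply RInt_ext. intros x. rewrite Rmin_left, Rmax_right by lra.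
  intros Hx. apply E. lra.
Qed.

(** With M a bound for |g|, the splitting g = (g + M) - M reduces existence to two nonnegative
    bounded integrands. *)
Lemma is_wint_poly (a b : R) (g : R -> R) : -1/2 <= a -> -1/2 <= b -> is_poly g ->
  is_wint a b g (wint a b g).
Proof.
  intros Ha Hb Hg. unfold wint. apply epsilon_spec.
  destruct (poly_bounded g Hg) as [M [HM B]].
  destruct (is_wint_exists_nonneg a b (fun x => g x + 1 * M)) as [l [Hl _]]; try assumption.
  - intros x. apply is_poly_continuous. apply (is_poly_lin 1 g (fun _ => M)); [exact Hg|].
    apply is_poly_const.
  - exists (2 * M). intros x Hx. assert (Hx' : -1 <= x <= 1) by lra.
    specialize (B x Hx'). apply Rabs_le_between in B. lra.
  - destruct (is_wint_exists_nonneg a b (fun _ => M)) as [l' [Hl' _]]; try assumption.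
    + intros x. apply continuous_const.
    + exists M. intros; lra.
    + exists (l + (-1) * l').
      replace g with (fun x => (g x + 1 * M) + (-1) * M)
        by (apply functional_extensionality; intro; ring).
      apply is_wint_lin; assumption.
Qed.

Lemma wint_lin (a b c : R) (f g : R -> R) : -1/2 <= a -> -1/2 <= b -> is_poly f -> is_poly g ->
  wint a b (fun x => f x + c * g x) = wint a b f + c * wint a b g.
Proof. intros. apply wint_eq, is_wint_lin; apply is_wint_poly; assumption. Qed.

Lemma wint_ext (a b : R) (f g : R -> R) : (forall x, f x = g x) -> wint a b f = wint a b g.
Proof. intros H. f_equal. apply functional_extensionality. exact H. Qed.

Lemma wint_zero (a b : R) : -1/2 <= a -> -1/2 <= b -> wint a b (fun _ => 0) = 0.
Proof.
  intros Ha Hb. rewrite (wint_ext a b _ (fun x => 1 + -1 * 1)) by (intros; ring).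
  rewrite (wint_lin a b (-1) (fun _ => 1) (fun _ => 1)) by (auto; apply is_poly_const). ring.
Qed.

Lemma wint_scal (a b c : R) (g : R -> R) : -1/2 <= a -> -1/2 <= b -> is_poly g ->
  wint a b (fun x => c * g x) = c * wint a b g.
Proof.
  intros Ha Hb Hg. pose proof (wint_lin a b c _ _ Ha Hb (is_poly_const 0) Hg) as H. simpl in H.
  rewrite wint_zero, Rplus_0_l in H by assumption. rewrite <- H. f_equal.
  apply functional_extensionality; intro; ring.
Qed.

Lemma pint_le_wint (a b : R) (g : R -> R) (u v : R) : -1/2 <= a -> -1/2 <= b -> is_poly g ->
  (forall x, -1 < x < 1 -> 0 <= g x) -> -1 < u -> u <= v -> v < 1 -> pint a b g u v <= wint a b g.
Proof.
  intros Ha Hb Hg H Hu Huv Hv.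
  destruct (is_wint_exists_nonneg a b g Ha Hb) as [l [Hl B]].
  - intros x. apply is_poly_continuous. exact Hg.
  - destruct (poly_bounded g Hg) as [M [_ B]]. exists M. intros x Hx. split; [auto|].
    apply Rle_trans with (Rabs (g x)); [apply Rle_abs|apply B; lra].
  - rewrite (wint_eq _ _ _ _ Hl). apply B; assumption.
Qed.

Lemma wint_ge0 (a b : R) (g : R -> R) : -1/2 <= a -> -1/2 <= b -> is_poly g ->
  (forall x, -1 < x < 1 -> 0 <= g x) -> 0 <= wint a b g.
Proof.
  intros Ha Hb Hg H. replace 0 with (pint a b g 0 0) by apply (RInt_point (V := R_CompleteNormedModule)).
  apply pint_le_wint; auto; lra.
Qed.

(** By continuity [g] is positive on a small interval around [x0] inside (-1, 1), and the truncated
    integral over that interval is already a positive lower bound. *)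
Lemma wint_gt0 (a b : R) (g : R -> R) (x0 : R) : -1/2 <= a -> -1/2 <= b -> is_poly g ->
  (forall x, -1 < x < 1 -> 0 <= g x) -> -1 < x0 < 1 -> g x0 <> 0 -> 0 < wint a b g.
Proof.
  intros Ha Hb Hg H Hx0 N. assert (P0 : 0 < g x0) by (pose proof (H x0 Hx0); lra).
  destruct (continuous_neighbourhood g x0 (is_poly_continuous g x0 Hg) _ P0) as [d [Hd B]].
  set (e := Rmin (d / 2) (Rmin ((1 - x0) / 2) ((1 + x0) / 2))).
  assert (He : 0 < e) by (repeat apply Rmin_pos; lra).
  assert (e <= d / 2 /\ e <= (1 - x0) / 2 /\ e <= (1 + x0) / 2) as [E1 [E2 E3]].
  { unfold e. repeat split; [apply Rmin_l| |];
      (eapply Rle_trans; [apply Rmin_r|]); [apply Rmin_l|apply Rmin_r]. }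
  apply Rlt_le_trans with (pint a b g (x0 - e) (x0 + e)).
  - apply RInt_gt_0; [lra| |].
    + intros x Hx. apply Rmult_lt_0_compat; [|apply jw_pos].
      assert (Ax : Rabs (x - x0) < d) by (apply Rabs_def1; lra).
      specialize (B x Ax). apply Rabs_def2 in B. lra.
    + intros x Hx. apply (continuous_mult g (jw a b)); [apply is_poly_continuous; exact Hg|].
      apply jw_continuous. lra.
  - apply pint_le_wint; auto; lra.
Qed.

Lemma wint_one_pos (a b : R) : -1/2 <= a -> -1/2 <= b -> 0 < wint a b (fun _ => 1).
Proof.
  intros. apply (wint_gt0 a b _ 0); try lra; try apply is_poly_const; intros; lra.
Qed.

Lemma wint_le (a b : R) (f g : R -> R) : -1/2 <= a -> -1/2 <= b -> is_poly f -> is_poly g ->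
  (forall x, -1 < x < 1 -> f x <= g x) -> wint a b f <= wint a b g.
Proof.
  intros Ha Hb Hf Hg H. pose proof (wint_lin a b (-1) g f Ha Hb Hg Hf).
  assert (0 <= wint a b (fun x => g x + -1 * f x)); [|lra].
  apply wint_ge0; auto; [apply is_poly_lin; assumption|]. intros x Hx. specialize (H x Hx). lra.
Qed.

(** Absorbing 1 - x into the weight is what trades the quadrature node at 1 for a raised
    exponent. *)
Lemma wint_shiftl (a b : R) (g : R -> R) : -1/2 <= a -> -1/2 <= b -> is_poly g ->
  wint (a + 1) b g = wint a b (fun x => (1 - x) * g x).
Proof.
  intros Ha Hb Hg. symmetry. apply wint_eq.
  apply (is_wint_transfer (a + 1) b a b g).
  - intros x. apply is_poly_continuous. apply (is_poly_mult (fun x => 1 - x)); [|exact Hg].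
    apply (is_poly_ext (fun x => 1 + (-1) * x)); [intros; ring|apply is_poly_affine].
  - intros x Hx. rewrite jw_shiftl by exact Hx. ring.
  - apply is_wint_poly; auto; lra.
Qed.

Lemma wint_shiftr (a b : R) (g : R -> R) : -1/2 <= a -> -1/2 <= b -> is_poly g ->
  wint a (b + 1) g = wint a b (fun x => (1 + x) * g x).
Proof.
  intros Ha Hb Hg. symmetry. apply wint_eq.
  apply (is_wint_transfer a (b + 1) a b g).
  - intros x. apply is_poly_continuous. apply (is_poly_mult (fun x => 1 + x)); [|exact Hg].
    apply (is_poly_ext (fun x => 1 + 1 * x)); [intros; ring|apply is_poly_affine].
  - intros x Hx. rewrite jw_shiftr by exact Hx. ring.
  - apply is_wint_poly; auto; lra.
Qed.

Lemma Rpower_small (c : R) : 0 < c -> forall eps, 0 < eps -> exists delta, 0 < delta /\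
  forall y, 0 < y < delta -> Rpower y c < eps.
Proof.
  intros Hc eps He. exists (Rpower eps (/ c)). split; [apply Rpower_pos|].
  intros y Hy. replace eps with (Rpower (Rpower eps (/ c)) c).
  - unfold Rpower at 1 2. apply exp_increasing, Rmult_lt_compat_l; [exact Hc|].
    apply ln_increasing; lra.
  - rewrite Rpower_mult, Rinv_l, Rpower_1; lra.
Qed.

(** Near either end one factor tends to 0 while the other stays below a power of 2. This disposes of
    the boundary terms in the integration by parts. *)
Lemma jw_small (a b : R) : 0 < a -> 0 < b -> forall eps, 0 < eps -> exists delta, 0 < delta /\
  forall x, -1 < x < 1 -> x < -1 + delta \/ 1 - delta < x -> jw a b x < eps.
Proof.
  intros Ha Hb eps He.
  set (K := Rpower 2 a + Rpower 2 b).
  assert (HK : 0 < K) by (pose proof (Rpower_pos 2 a); pose proof (Rpower_pos 2 b); unfold K; lra).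
  assert (He' : 0 < eps / K) by (apply Rdiv_lt_0_compat; lra).
  destruct (Rpower_small a Ha _ He') as [d [Hd P]].
  destruct (Rpower_small b Hb _ He') as [d' [Hd' P']].
  exists (Rmin d d'). split; [apply Rmin_pos; lra|].
  pose proof (Rmin_l d d'). pose proof (Rmin_r d d').
  intros x Hx. unfold jw.
  assert (A1 : Rpower (1 - x) a <= Rpower 2 a) by (apply Rle_Rpower_l; lra).
  assert (A2 : Rpower (1 + x) b <= Rpower 2 b) by (apply Rle_Rpower_l; lra).
  pose proof (Rpower_pos (1 - x) a). pose proof (Rpower_pos (1 + x) b).
  pose proof (Rpower_pos 2 a). pose proof (Rpower_pos 2 b).
  replace eps with (eps / K * K) by (field; lra).
  intros [L|L].
  - assert (Q : Rpower (1 + x) b < eps / K) by (apply P'; lra). unfold K at 2. nra.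
  - assert (Q : Rpower (1 - x) a < eps / K) by (apply P; lra). unfold K at 2. nra.
Qed.

(* The integrand is the derivative of (1-x)^(a+1) (1+x)^(b+1), which vanishes at both ends. *)
Lemma wint_by_parts (a b : R) : -1/2 <= a -> -1/2 <= b ->
  wint a b (fun x => (b + 1) * (1 - x) + - (a + 1) * (1 + x)) = 0.
Proof.
  intros Ha Hb. apply wint_eq.
  assert (Hp : is_poly (fun x => (b + 1) * (1 - x) + - (a + 1) * (1 + x))).
  { apply (is_poly_ext (fun x => (b - a) + (- (a + b + 2)) * x)); [intros; ring|apply is_poly_affine]. }
  apply is_wint_intro; [intros; apply is_poly_continuous; exact Hp|].
  intros eps He. destruct (jw_small (a + 1) (b + 1)) with (eps := eps) as [d [Hd P]]; try lra.
  exists (Rmin d 1). split; [apply Rmin_pos; lra|].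
  intros u v Hu Hv. pose proof (Rmin_l d 1). pose proof (Rmin_r d 1).
  assert (I : pint a b (fun x => (b + 1) * (1 - x) + - (a + 1) * (1 + x)) u v
              = jw (a + 1) (b + 1) v - jw (a + 1) (b + 1) u).
  { unfold pint. apply is_RInt_unique.
    apply (is_RInt_derive (jw (a + 1) (b + 1))); intros x; rewrite Rmin_left, Rmax_right by lra;
      intros Hx.
    - assert (Hx' : -1 < x < 1) by lra.
      replace (((b + 1) * (1 - x) + - (a + 1) * (1 + x)) * jw a b x)
        with (((b + 1) / (1 + x) - (a + 1) / (1 - x)) * jw (a + 1) (b + 1) x)
        by (rewrite jw_shiftl, jw_shiftr by exact Hx'; field; lra).
      unfold jw, Rpower. auto_derive; [repeat split; lra|].
      replace (1 + - x) with (1 - x) by ring. field. lra.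
    - apply (continuous_mult _ (jw a b)); [apply is_poly_continuous; exact Hp|].
      apply jw_continuous. lra. }
  rewrite I. pose proof (P u). pose proof (P v).
  pose proof (jw_pos (a + 1) (b + 1) u). pose proof (jw_pos (a + 1) (b + 1) v).
  apply Rabs_def1; [assert (jw (a + 1) (b + 1) v < eps) by (apply H2; lra)|
                    assert (jw (a + 1) (b + 1) u < eps) by (apply H1; lra)]; lra.
Qed.

(** * Orthogonality of the Jacobi polynomials *)

(** The Pochhammer symbol c (c + 1) ... (c + k - 1), standing in for quotients of Gamma values. *)
Fixpoint rise (c : R) (k : nat) : R :=
  match k with
  | O => 1
  | S j => rise c j * (c + INR j)
  end.

Lemma rise_pos (c : R) (k : nat) : 0 < c -> 0 < rise c k.
Proof.
  intros Hc. induction k as [|k IH]; simpl; [lra|].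
  pose proof (pos_INR k). apply Rmult_lt_0_compat; lra.
Qed.

Lemma rise_add (c : R) (k j : nat) : rise c (k + j) = rise c k * rise (c + INR k) j.
Proof.
  induction j as [|j IH]; simpl; [rewrite Nat.add_0_r; ring|].
  rewrite Nat.add_succ_r. simpl. rewrite IH, plus_INR. ring.
Qed.

Lemma rise_Sl (c : R) (k : nat) : rise c (S k) = c * rise (c + 1) k.
Proof. change (S k) with (1 + k)%nat. rewrite rise_add. simpl. rewrite Rplus_0_r. ring. Qed.

(** The falling product in a generalized binomial is the quotient (a + 1)_{k+j} / (a + 1)_k of
    Pochhammer symbols, stated here without division. *)
Lemma gprod_rise (a : R) (k j : nat) :
  gprod (INR (k + j) + a) j * rise (a + 1) k = rise (a + 1) (k + j).
Proof.
  revert k. induction j as [|j IH]; intros k; [rewrite Nat.add_0_r; simpl; ring|].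
  rewrite Nat.add_succ_r. pose proof (IH (S k)) as H.
  change (S k + j)%nat with (S (k + j)) in H. rewrite <- H.
  cbn [gprod rise]. rewrite !S_INR, plus_INR. ring.
Qed.

(** Pascal's rule: up to sign, a finite difference of order n + 1 is the difference of order n of
    the first difference. *)
Lemma alternating_binomial_S (n : nat) (q : nat -> R) :
  sum_f_R0 (fun k => (-1) ^ k * Binomial.C (S n) k * q k) (S n) =
  sum_f_R0 (fun k => (-1) ^ k * Binomial.C n k * (q k - q (S k))) n.
Proof.
  assert (C0 : forall i, Binomial.C i 0 = 1).
  { intros i. unfold Binomial.C. rewrite Nat.sub_0_r. simpl. field. apply INR_fact_neq_0. }
  assert (Cn : forall i, Binomial.C i i = 1).
  { intros i. unfold Binomial.C. rewrite Nat.sub_diag. simpl. field. apply INR_fact_neq_0. }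
  destruct n as [|m].
  { simpl. rewrite !C0, Cn. ring. }
  rewrite (sum_eq _ (fun k => (-1) ^ k * Binomial.C (S m) k * q k -
    (-1) ^ k * Binomial.C (S m) k * q (S k)) (S m)) by (intros; ring).
  rewrite minus_sum.
  rewrite (decomp_sum (fun k => (-1) ^ k * Binomial.C (S m) k * q k)) by lia.
  rewrite decomp_sum by lia. simpl pred.
  rewrite !tech5.
  rewrite (sum_eq _ (fun k => (-1) ^ (S k) * Binomial.C (S m) (S k) * q (S k) -
    (-1) ^ k * Binomial.C (S m) k * q (S k)) m).
  2: { intros i Hi. rewrite <- (pascal (S m) i) by lia. simpl. ring. }
  rewrite minus_sum, !C0, !Cn. simpl. ring.
Qed.

(** The rising factorial is a polynomial of degree l in k, and a difference of order n > l
    annihilates it. One difference step lowers the length of the rising factorial by one and keeps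
    [c], contributing only the factor l + 1, so the induction closes. *)
Lemma alternating_binomial_rise (n l : nat) (c : R) : (l < n)%nat ->
  sum_f_R0 (fun k => (-1) ^ k * Binomial.C n k * rise (c - INR k) l) n = 0.
Proof.
  revert l c. induction n as [|n IH]; intros l c Hl; [lia|].
  rewrite alternating_binomial_S. destruct l as [|l].
  - simpl rise. rewrite (sum_eq _ (fun _ => 0)) by (intros; ring).
    rewrite sum_eq_R0; auto.
  - rewrite (sum_eq _ (fun k => (-1) ^ k * Binomial.C n k * rise (c - INR k) l * INR (S l))).
    + rewrite <- scal_sum, IH by lia. ring.
    + intros k _. rewrite (rise_Sl (c - INR (S k))), S_INR.
      replace (c - (INR k + 1) + 1) with (c - INR k) by ring.
      simpl rise. rewrite S_INR. ring.
Qed.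

Lemma is_poly_one_minus : is_poly (fun x => 1 - x).
Proof. apply (is_poly_ext (fun x => 1 + (-1) * x)); [intros; ring|apply is_poly_affine]. Qed.

Lemma is_poly_one_plus : is_poly (fun x => 1 + x).
Proof. apply (is_poly_ext (fun x => 1 + 1 * x)); [intros; ring|apply is_poly_affine]. Qed.

(** The integrals X of 1 - x and Y of 1 + x satisfy two linear relations: (b + 1) X = (a + 1) Y from
    integration by parts, and X + Y = 2 W. Solving them gives both shifts. *)
Lemma wint_one_shiftl (a b : R) : -1/2 <= a -> -1/2 <= b ->
  (a + b + 2) * wint (a + 1) b (fun _ => 1) = 2 * (a + 1) * wint a b (fun _ => 1) /\
  (a + b + 2) * wint a (b + 1) (fun _ => 1) = 2 * (b + 1) * wint a b (fun _ => 1).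
Proof.
  intros Ha Hb.
  pose proof (is_poly_const 1) as P1.
  pose proof is_poly_one_minus as Pl. pose proof is_poly_one_plus as Pr.
  rewrite wint_shiftl, wint_shiftr by assumption.
  rewrite (wint_ext a b _ (fun x => 1 - x)) by (intros; ring).
  rewrite (wint_ext a b (fun x => (1 + x) * 1) (fun x => 1 + x)) by (intros; ring).
  pose proof (wint_by_parts a b Ha Hb) as H.
  rewrite (wint_lin a b _ (fun x => (b + 1) * (1 - x)) (fun x => 1 + x)) in H
    by (try apply is_poly_scal; assumption).
  rewrite wint_scal in H by assumption.
  pose proof (wint_lin a b 1 _ _ Ha Hb Pl Pr) as H'. simpl in H'.
  rewrite (wint_ext a b (fun x => 1 - x + 1 * (1 + x)) (fun x => 2 * 1)) in H' by (intros; ring).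
  rewrite (wint_scal a b 2 (fun _ => 1)) in H' by assumption.
  set (X := wint a b (fun x => 1 - x)) in *. set (Y := wint a b (fun x => 1 + x)) in *.
  set (W := wint a b (fun _ => 1)) in *.
  assert (E1 : (b + 1) * X = (a + 1) * Y) by lra. assert (E2 : X + Y = 2 * W) by lra.
  split.
  - replace (2 * (a + 1) * W) with ((a + 1) * (X + Y)) by (rewrite E2; ring).
    replace ((a + b + 2) * X) with ((a + 1) * X + (b + 1) * X) by ring. rewrite E1. ring.
  - replace (2 * (b + 1) * W) with ((b + 1) * (X + Y)) by (rewrite E2; ring).
    rewrite Rmult_plus_distr_l, E1. ring.
Qed.

(** The quotient of Beta functions B(a + k + 1, b + j + 1) / B(a + 1, b + 1), obtained by iterating
    the unit shifts. *)
Lemma wint_one_rise (a b : R) (k j : nat) : -1/2 <= a -> -1/2 <= b ->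
  rise (a + b + 2) (k + j) * wint (a + INR k) (b + INR j) (fun _ => 1) =
  2 ^ (k + j) * rise (a + 1) k * rise (b + 1) j * wint a b (fun _ => 1).
Proof.
  intros Ha Hb. induction k as [|k IH].
  - simpl Nat.add. simpl INR. rewrite Rplus_0_r. simpl (rise (a + 1) 0). rewrite Rmult_1_r.
    induction j as [|j IH]; [simpl; rewrite !Rplus_0_r; ring|].
    rewrite S_INR. simpl rise. simpl pow.
    pose proof (pos_INR j).
    destruct (wint_one_shiftl a (b + INR j)) as [_ H']; [lra|lra|].
    replace (b + (INR j + 1)) with (b + INR j + 1) by ring.
    replace (a + b + 2 + INR j) with (a + (b + INR j) + 2) by ring.
    rewrite Rmult_assoc, H'.
    transitivity (2 * (b + INR j + 1) * (rise (a + b + 2) j * wint a (b + INR j) (fun _ => 1)));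
      [ring|]. rewrite IH. simpl. ring.
  - simpl Nat.add. simpl rise. simpl pow. rewrite S_INR.
    pose proof (pos_INR j). pose proof (pos_INR k).
    destruct (wint_one_shiftl (a + INR k) (b + INR j)) as [H' _]; [lra|lra|].
    replace (a + (INR k + 1)) with (a + INR k + 1) by ring.
    replace (a + b + 2 + INR (k + j)) with (a + INR k + (b + INR j) + 2) by (rewrite plus_INR; ring).
    rewrite Rmult_assoc, H'.
    transitivity (2 * (a + INR k + 1) *
      (rise (a + b + 2) (k + j) * wint (a + INR k) (b + INR j) (fun _ => 1)));
      [ring|]. rewrite IH. ring.
Qed.

Lemma wint_moment (a b : R) (k j : nat) : -1/2 <= a -> -1/2 <= b ->
  wint a b (fun x => (1 - x) ^ k * (1 + x) ^ j) = wint (a + INR k) (b + INR j) (fun _ => 1).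
Proof.
  revert a b j. induction k as [|k IH].
  - intros a b j. revert b. induction j as [|j IH]; intros b Ha Hb.
    + simpl. rewrite !Rplus_0_r. apply wint_ext. intros; ring.
    + rewrite S_INR. replace (b + (INR j + 1)) with (b + 1 + INR j) by ring.
      rewrite <- IH by lra. rewrite wint_shiftr; auto.
      * apply wint_ext. intros; simpl; ring.
      * apply (is_poly_mult (fun x => (1 - x) ^ 0)); apply is_poly_pow;
          [apply is_poly_one_minus|apply is_poly_one_plus].
  - intros a b j Ha Hb. rewrite S_INR. replace (a + (INR k + 1)) with (a + 1 + INR k) by ring.
    rewrite <- IH by lra. rewrite wint_shiftl; auto.
    + apply wint_ext. intros; simpl; ring.
    + apply (is_poly_mult (fun x => (1 - x) ^ k)); apply is_poly_pow;
        [apply is_poly_one_minus|apply is_poly_one_plus].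
Qed.

Lemma is_poly_sum (F : nat -> R -> R) (n : nat) : (forall i, is_poly (F i)) ->
  is_poly (fun x => sum_f_R0 (fun i => F i x) n).
Proof.
  intros H. induction n as [|n IH]; simpl; [apply H|apply is_poly_plus; [exact IH|apply H]].
Qed.

Lemma wint_sum (a b : R) (F : nat -> R -> R) (n : nat) : -1/2 <= a -> -1/2 <= b ->
  (forall i, is_poly (F i)) ->
  wint a b (fun x => sum_f_R0 (fun i => F i x) n) = sum_f_R0 (fun i => wint a b (F i)) n.
Proof.
  intros Ha Hb H. induction n as [|n IH]; simpl; [apply wint_ext; reflexivity|].
  rewrite (wint_ext _ _ _ (fun x => sum_f_R0 (fun i => F i x) n + 1 * F (S n) x))
    by (intros; ring).
  rewrite wint_lin by (auto; apply is_poly_sum; exact H). rewrite IH. ring.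
Qed.

Lemma jacobiP_deg (a b : R) (n : nat) : poly_deg_le (jacobiP a b n) n.
Proof.
  unfold jacobiP. apply (poly_deg_le_sum (fun k x =>
    gbinom (INR n + a) (n - k) * gbinom (INR n + b) k * ((x - 1) / 2) ^ k * ((x + 1) / 2) ^ (n - k))).
  intros k Hk.
  apply (poly_deg_le_ext (fun x => gbinom (INR n + a) (n - k) * gbinom (INR n + b) k *
    ((- / 2 + / 2 * x) ^ k * (/ 2 + / 2 * x) ^ (n - k)))).
  - intros x. rewrite !Rmult_assoc. do 2 f_equal. f_equal; f_equal; field.
  - apply poly_deg_le_scal. apply (poly_deg_le_weaken _ (k * 1 + (n - k) * 1)); [|lia].
    apply (poly_deg_le_mult (fun x => (- / 2 + / 2 * x) ^ k)); apply poly_deg_le_pow; apply poly_deg_le_affine.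
Qed.

Lemma jacobiP_is_poly (a b : R) (n : nat) : is_poly (jacobiP a b n).
Proof. exists n. apply jacobiP_deg. Qed.

(** Powers of 1 + x merge with those already in the explicit sum, so every term is a pure moment.
    After simplification the k-th term is a constant times (-1)^k C(n,k) (b + 1 + n - k)_l, and the
    alternating sum of these is zero. *)
Lemma jacobiP_orthogonal_pow (a b : R) (n l : nat) : -1/2 <= a -> -1/2 <= b -> (l < n)%nat ->
  wint a b (fun x => jacobiP a b n x * (1 + x) ^ l) = 0.
Proof.
  intros Ha Hb Hl.
  set (A := fun k => gbinom (INR n + a) (n - k) * gbinom (INR n + b) k * (-1) ^ k * / 2 ^ n).
  rewrite (wint_ext a b _ (fun x => sum_f_R0 (fun k => A k *
    ((1 - x) ^ k * (1 + x) ^ (n - k + l))) n)).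
  2: { intros x. unfold jacobiP. rewrite Rmult_comm, scal_sum. apply sum_eq. intros k Hk.
       unfold A. rewrite pow_add.
       replace ((x - 1) / 2) with ((-1) * (1 - x) * / 2) by field.
       replace ((x + 1) / 2) with ((1 + x) * / 2) by field.
       replace (2 ^ n) with (2 ^ k * 2 ^ (n - k)) by (rewrite <- pow_add; f_equal; lia).
       rewrite !Rpow_mult_distr, Rinv_mult, !pow_inv. ring. }
  assert (Pk : forall k j, is_poly (fun x => (1 - x) ^ k * (1 + x) ^ j)).
  { intros. apply is_poly_mult; apply is_poly_pow;
      [apply is_poly_one_minus|apply is_poly_one_plus]. }
  rewrite (wint_sum a b (fun k x => A k * ((1 - x) ^ k * (1 + x) ^ (n - k + l)))); auto.
  2: { intros k. apply is_poly_scal. apply Pk. }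
  (* All moments have total exponent n + l, so they share the denominator [T]; [K] below gathers the
     other factors independent of k. *)
  set (T := rise (a + b + 2) (n + l)).
  assert (HT : 0 < T) by (apply rise_pos; lra).
  set (K := 2 ^ l * rise (a + 1) n * rise (b + 1) n * wint a b (fun _ => 1) / INR (Factorial.fact n)).
  rewrite (sum_eq _ (fun k => (-1) ^ k * Binomial.C n k * rise (b + 1 + INR n - INR k) l * (K / T))).
  - rewrite <- scal_sum, alternating_binomial_rise by exact Hl. ring.
  - intros k Hk. rewrite wint_scal, wint_moment by auto.
    apply (Rmult_eq_reg_l T); [|lra].
    transitivity (A k * (T * wint (a + INR k) (b + INR (n - k + l)) (fun _ => 1))); [ring|].
    unfold T. replace (n + l)%nat with (k + (n - k + l))%nat at 1 by lia.
    rewrite wint_one_rise by assumption. fold T.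
    replace (k + (n - k + l))%nat with (n + l)%nat by lia.
    rewrite rise_add. unfold A, gbinom.
    pose proof (gprod_rise a k (n - k)) as G1. replace (k + (n - k))%nat with n in G1 by lia.
    pose proof (gprod_rise b (n - k) k) as G2. replace (n - k + k)%nat with n in G2 by lia.
    unfold K. rewrite <- G1 at 1. rewrite <- G2 at 1. unfold Binomial.C.
    replace (b + 1 + INR n - INR k) with (b + 1 + INR (n - k)) by (rewrite minus_INR by lia; ring).
    rewrite pow_add. field.
    repeat split; try apply INR_fact_neq_0; try lra. apply pow_nonzero; lra.
Qed.

Lemma jacobiP_orthogonal (a b : R) (n d : nat) (q : R -> R) : -1/2 <= a -> -1/2 <= b ->
  poly_deg_le q d -> (d < n)%nat -> wint a b (fun x => jacobiP a b n x * q x) = 0.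
Proof.
  intros Ha Hb Hq Hd.
  (* Expansion of [q] in powers of 1 + x by repeated division at -1; the exponent l records the
     factors already split off, and d + l stays below n. *)
  assert (G : forall d l q, poly_deg_le q d -> (d + l < n)%nat ->
    wint a b (fun x => jacobiP a b n x * (1 + x) ^ l * q x) = 0).
  2: { rewrite <- (G d 0%nat q Hq) by lia. apply wint_ext. intros; simpl; ring. }
  assert (Pk : forall l, is_poly (fun x => jacobiP a b n x * (1 + x) ^ l)).
  { intros. apply is_poly_mult; [apply jacobiP_is_poly|apply is_poly_pow, is_poly_one_plus]. }
  clear d q Hq Hd. induction d as [|d IH]; intros l q Hq Hl.
  - apply poly_deg_le_0 in Hq. destruct Hq as [c Hq].
    rewrite (wint_ext _ _ _ (fun x => c * (jacobiP a b n x * (1 + x) ^ l)))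
      by (intros; rewrite Hq; ring).
    rewrite wint_scal, jacobiP_orthogonal_pow by (auto; lia). ring.
  - destruct (poly_div_root q d (-1) Hq) as [q1 [Hq1 E]].
    rewrite (wint_ext _ _ _ (fun x => jacobiP a b n x * (1 + x) ^ (S l) * q1 x
      + q (-1) * (jacobiP a b n x * (1 + x) ^ l))) by (intros; rewrite E; simpl; ring).
    rewrite wint_lin; auto.
    + rewrite IH, jacobiP_orthogonal_pow by (auto; lia). ring.
    + apply (is_poly_mult (fun x => jacobiP a b n x * (1 + x) ^ S l)); [apply Pk|].
      exists d. exact Hq1.
Qed.

(** * Zeros and Gauss quadrature *)

(** With fewer than n sign changes in (-1, 1), multiplying by the product over them would give a
    nonzero polynomial of constant sign whose integral vanishes by orthogonality. Hence there are n
    of them and they use up the degree. The point [y] guarantees that the polynomial is not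
    identically zero. *)
Lemma jacobiP_factor (a b : R) (n : nat) (y : R) : -1/2 <= a -> -1/2 <= b ->
  jacobiP a b n y <> 0 ->
  exists l K, NoDup l /\ (forall z, In z l -> -1 < z < 1) /\ length l = n /\ K <> 0 /\
    forall x, jacobiP a b n x = K * lprod l x.
Proof.
  intros Ha Hb Hy.
  destruct (poly_sign_changes n _ (jacobiP_deg a b n)) as [l [r [k [ND [Hl [Len [Hr [E Sg]]]]]]]].
  assert (Pl := lprod_is_poly l). assert (Pr : is_poly r) by (exists k; exact Hr).
  assert (L : length l = n).
  { destruct (Nat.lt_ge_cases (length l) n) as [Lt|]; [exfalso|lia].
    assert (Pf : is_poly (fun x => lprod l x ^ 2 * r x))
      by (apply is_poly_mult; [apply is_poly_pow|]; assumption).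
    assert (N : lprod l y ^ 2 * r y <> 0).
    { rewrite E in Hy. apply Rmult_integral_contrapositive.
      split; [apply pow_nonzero|]; intro Z; apply Hy; rewrite Z; ring. }
    destruct (poly_nonzero_in_interval _ y Pf N) as [t [Ht Nt]].
    assert (O : wint a b (fun x => lprod l x ^ 2 * r x) = 0).
    { rewrite <- (jacobiP_orthogonal a b n (length l) (lprod l) Ha Hb (lprod_deg l) Lt).
      apply wint_ext. intros x. rewrite E. ring. }
    destruct Sg as [Sg|Sg].
    - assert (0 < wint a b (fun x => lprod l x ^ 2 * r x)); [|lra].
      apply (wint_gt0 a b _ t); auto. intros x Hx. specialize (Sg x Hx).
      pose proof (pow2_ge_0 (lprod l x)). nra.
    - assert (0 < wint a b (fun x => (-1) * (lprod l x ^ 2 * r x))).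
      + apply (wint_gt0 a b _ t); auto; [apply is_poly_scal; exact Pf| |lra].
        intros x Hx. specialize (Sg x Hx). pose proof (pow2_ge_0 (lprod l x)). nra.
      + rewrite wint_scal in H by assumption. lra. }
  replace k with 0%nat in Hr by lia. apply poly_deg_le_0 in Hr. destruct Hr as [K HK].
  exists l, K. repeat split; auto; try (apply Hl; assumption).
  - intros ->. apply Hy. rewrite E, HK. ring.
  - intros x. rewrite E, HK. ring.
Qed.

(* Gauss quadrature in one-sided form, with the squares of the Lagrange polynomials giving the
   positive weights; the nodes outside [t] have already been cleared. *)
Lemma gauss_clear_nodes (a b : R) (l : list R) (k : nat) (t : list R) (g : R -> R) :
  -1/2 <= a -> -1/2 <= b -> NoDup l -> (forall z, In z l -> -1 < z < 1) -> length l = S k ->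
  (forall q, poly_deg_le q k -> wint a b (fun x => lprod l x * q x) = 0) ->
  NoDup t -> incl t l ->
  poly_deg_le g (k + length l) -> (forall z, In z t -> 0 <= g z) ->
  (forall z, In z l -> ~ In z t -> g z = 0) ->
  0 <= wint a b g /\ (wint a b g <= 0 -> forall z, In z t -> g z = 0).
Proof.
  intros Ha Hb ND Hl Hk Orth. revert g. induction t as [|z t IH]; intros g NDt Ht Hg Hpos Hz.
  (* Once every node is cleared, [g] is the node polynomial times a factor of degree at most k,
     which orthogonality integrates to zero. *)
  - destruct (poly_div_roots l k g ND Hg) as [q [Hq E]].
    { intros z Iz. apply Hz; [exact Iz|intros []]. }
    rewrite (wint_ext a b g _ E), Orth by exact Hq. split; [lra|intros _ z []].
  - inversion NDt as [|? ? Nz NDt']; subst.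
    assert (Iz : In z l) by (apply Ht; left; reflexivity).
    destruct (in_split z l Iz) as [l1 [l2 El]].
    assert (Nl : ~ In z (l1 ++ l2)) by (apply NoDup_remove_2; rewrite <- El; exact ND).
    set (m := lprod (l1 ++ l2)).
    assert (Nm : m z <> 0) by (intro Z; apply Nl, lprod_root; exact Z).
    set (w := fun x => (m x / m z) ^ 2).
    assert (Dw : poly_deg_le w (k + length l)).
    { apply (poly_deg_le_weaken _ (2 * length (l1 ++ l2))).
      - apply (poly_deg_le_ext (fun x => (/ m z * m x) ^ 2)).
        + intros x. unfold w. f_equal. unfold Rdiv. ring.
        + apply (poly_deg_le_pow (fun x => / m z * m x)). apply poly_deg_le_scal, lprod_deg.
      - assert (length (l1 ++ l2) = k); [|lia].
        rewrite El, length_app in Hk. simpl in Hk. rewrite length_app. lia. }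
    assert (Pw : is_poly w) by (eexists; exact Dw). assert (Pg : is_poly g) by (eexists; exact Hg).
    assert (wz : w z = 1) by (unfold w; field; exact Nm).
    assert (wy : forall y, In y l -> y <> z -> w y = 0).
    { intros y Iy Ny. unfold w. replace (m y) with 0; [unfold Rdiv; ring|].
      symmetry. apply lprod_root. rewrite El in Iy. apply in_app_iff in Iy. apply in_app_iff.
      destruct Iy as [|[|]]; [auto|congruence|auto]. }
    assert (W : 0 < wint a b w).
    { apply (wint_gt0 a b w z); auto; [intros x _; apply pow2_ge_0|lra]. }
    (* [w] is 1 at z and 0 at the other nodes: the subtraction clears z, leaves the other values
       alone, and lowers the integral by a nonnegative amount. *)
    destruct (IH (fun x => g x + (- g z) * w x)) as [I1 I2].
    + exact NDt'.
    + intros y Iy. apply Ht. right. exact Iy.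
    + apply poly_deg_le_plus; [exact Hg|apply poly_deg_le_scal; exact Dw].
    + intros y Iy. rewrite wy; [|apply Ht; right; exact Iy|intros ->; contradiction].
      rewrite Rmult_0_r, Rplus_0_r. apply Hpos. right. exact Iy.
    + intros y Iy Ny. destruct (Req_dec y z) as [->|N]; [rewrite wz; ring|].
      rewrite wy by assumption. rewrite Hz; [ring|exact Iy|].
      intros [->|]; [apply N; reflexivity|contradiction].
    + rewrite wint_lin in I1, I2 by assumption.
      assert (G0 : 0 <= g z) by (apply Hpos; left; reflexivity).
      assert (0 <= g z * wint a b w) by (apply Rmult_le_pos; lra).
      split; [lra|]. intros Hle.
      assert (Gz : g z = 0).
      { apply (Rmult_eq_reg_r (wint a b w)); [|lra]. lra. }
      intros y [<-|Iy]; [exact Gz|].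
      assert (Z := I2 ltac:(lra) y Iy). simpl in Z. rewrite Gz in Z. lra.
Qed.

(** The instance t = l of the preceding induction, with no node cleared yet. *)
Lemma gauss_nodes_vanish (a b : R) (l : list R) (k : nat) (g : R -> R) :
  -1/2 <= a -> -1/2 <= b -> NoDup l -> (forall z, In z l -> -1 < z < 1) -> length l = S k ->
  (forall q, poly_deg_le q k -> wint a b (fun x => lprod l x * q x) = 0) ->
  poly_deg_le g (k + length l) ->
  (forall z, In z l -> 0 <= g z) ->
  0 <= wint a b g /\ (wint a b g <= 0 -> forall z, In z l -> g z = 0).
Proof.
  intros Ha Hb ND Hl Hk Orth Hg Hpos. apply (gauss_clear_nodes a b l k l); auto.
  - apply incl_refl.
  - intros z H N. contradiction.
Qed.

(** If r(z) were nonzero, [r] would keep its sign near z and (x - z) r(x) would change sign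
    there. *)
Lemma nonneg_root_double (g r : R -> R) (z d : R) : continuous r z -> 0 < d ->
  (forall x, g x = (x - z) * r x) -> (forall x, Rabs (x - z) < d -> 0 <= g x) -> r z = 0.
Proof.
  intros Hc Hd E H. apply NNPP. intro N. pose proof (Rabs_pos_lt _ N) as N'.
  destruct (continuous_neighbourhood r z Hc _ N') as [e [He P]].
  set (t := Rmin d e / 2). pose proof (Rmin_l d e). pose proof (Rmin_r d e).
  assert (0 < Rmin d e) by (apply Rmin_pos; lra).
  assert (A1 : Rabs (z + t - z) < Rmin d e) by (apply Rabs_def1; unfold t; lra).
  assert (A2 : Rabs (z - t - z) < Rmin d e) by (apply Rabs_def1; unfold t; lra).
  assert (G1 : 0 <= g (z + t)) by (apply H; lra).
  assert (G2 : 0 <= g (z - t)) by (apply H; lra).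
  assert (P1 := P (z + t) ltac:(lra)). assert (P2 := P (z - t) ltac:(lra)).
  rewrite E in G1, G2. replace (z + t - z) with t in G1 by ring.
  replace (z - t - z) with (- t) in G2 by ring. assert (0 < t) by (unfold t; lra).
  apply Rabs_def2 in P1. apply Rabs_def2 in P2.
  unfold Rabs in *. destruct (Rcase_abs (r z)); nra.
Qed.

(** At a node other than [x1], [g] is nonnegative on both sides, so the root is double and the
    quotient of [g] by the node polynomial vanishes there again. At [x1] the sign is known only on
    the left, so that root may stay simple. *)
Lemma extremal_form (l : list R) (k : nat) (x1 : R) (g : R -> R) : NoDup l ->
  (forall z, In z l -> -1 < z < 1) -> length l = S k -> In x1 l -> (forall z, In z l -> z <= x1) ->
  poly_deg_le g (k + length l) -> (forall z, In z l -> g z = 0) ->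
  (forall x, -1 < x < x1 -> 0 <= g x) ->
  exists c, forall x, (x1 - x) * g x = c * lprod l x ^ 2.
Proof.
  intros ND Hl Hk I1 Hmax Hg Hz Hpos.
  destruct (poly_div_roots l k g ND Hg Hz) as [q [Hq E]].
  destruct (in_split x1 l I1) as [l1 [l2 El]].
  assert (ND' : NoDup (l1 ++ l2)) by (apply (NoDup_remove_1 _ _ x1); rewrite <- El; exact ND).
  assert (N1 : ~ In x1 (l1 ++ l2)) by (apply NoDup_remove_2; rewrite <- El; exact ND).
  assert (Len : length (l1 ++ l2) = k) by (rewrite El, length_app in Hk; simpl in Hk; rewrite length_app; lia).
  assert (Qz : forall z, In z (l1 ++ l2) -> q z = 0).
  { intros z Iz. assert (Nz : z <> x1) by (intros ->; contradiction).
    assert (Il : In z l).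
    { rewrite El. apply in_app_iff. apply in_app_iff in Iz. simpl. tauto. }
    assert (z <= x1) by (apply Hmax; exact Il). assert (-1 < z < 1) by (apply Hl; exact Il).
    destruct (in_split z _ Iz) as [m1 [m2 Em]].
    assert (Nm : ~ In z (m1 ++ m2)) by (apply NoDup_remove_2; rewrite <- Em; exact ND').
    (* [r] is [g] with one factor x - z removed. Its factors other than [q] do not vanish at z, so
       r(z) = 0 forces q(z) = 0. *)
    set (r := fun x => (x - x1) * lprod (m1 ++ m2) x * q x).
    assert (R0 : r z = 0).
    { apply (nonneg_root_double g r z (Rmin (x1 - z) (z + 1))).
      - apply is_poly_continuous. apply (is_poly_mult (fun x => (x - x1) * lprod (m1 ++ m2) x)).
        + apply is_poly_mult; [|apply lprod_is_poly].
          apply (is_poly_ext (fun x => - x1 + 1 * x)); [intros; ring|apply is_poly_affine].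
        + exists k. exact Hq.
      - apply Rmin_pos; lra.
      - intros x. rewrite E, El, lprod_app_cons, Em, lprod_app_cons. unfold r. ring.
      - intros x Hx. pose proof (Rmin_l (x1 - z) (z + 1)). pose proof (Rmin_r (x1 - z) (z + 1)).
        apply Rabs_def2 in Hx. apply Hpos. lra. }
    unfold r in R0. apply Rmult_integral in R0. destruct R0 as [R0|]; [|assumption].
    apply Rmult_integral in R0. destruct R0 as [R0|R0]; [lra|].
    apply lprod_root in R0. contradiction. }
  (* The k zeros found exhaust the degree of [q], leaving a constant. *)
  destruct (poly_div_roots (l1 ++ l2) 0 q ND') as [s [Hs E']]; [rewrite Len; exact Hq|exact Qz|].
  apply poly_deg_le_0 in Hs. destruct Hs as [c Hc].
  exists (- c). intros x. rewrite E, E', Hc, El, lprod_app_cons. ring.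
Qed.

(** * The functionals [rf], [kf] and [distray] *)

(** Gathers the two normalizations, of the polynomial and of the weight, so that coefficients become
    plain integrals against [jacobiP]. *)
Definition jacobi_scale (a b : R) (n : nat) : R :=
  / sqrt (wmean a b (fun y => jacobiP a b n y ^ 2)) / wint a b (fun _ => 1).

Lemma fhat_eq (a b : R) (f : R -> R) (n : nat) : -1/2 <= a -> -1/2 <= b -> is_poly f ->
  fhat a b f n = jacobi_scale a b n * wint a b (fun x => f x * jacobiP a b n x).
Proof.
  intros Ha Hb Hf. unfold fhat, wmean at 1, jacobi_p, jacobi_scale.
  set (K := sqrt _).
  rewrite (wint_ext a b _ (fun x => / K * (f x * jacobiP a b n x)))
    by (intros; unfold Rdiv; ring).
  rewrite wint_scal; auto; [unfold Rdiv; ring|].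
  apply is_poly_mult; [exact Hf|apply jacobiP_is_poly].
Qed.

Lemma jacobiP_0 (a b x : R) : jacobiP a b 0 x = 1.
Proof. unfold jacobiP, gbinom. simpl. field. Qed.

Lemma fhat_0 (a b : R) : -1/2 <= a -> -1/2 <= b ->
  exists K, 0 < K /\ forall f, is_poly f -> fhat a b f 0 = K * wint a b f.
Proof.
  intros Ha Hb. pose proof (wint_one_pos a b Ha Hb) as W. exists (jacobi_scale a b 0). split.
  - unfold jacobi_scale, wmean. rewrite (wint_ext _ _ _ (fun _ => 1)).
    + apply Rmult_lt_0_compat; apply Rinv_0_lt_compat; [|exact W].
      apply sqrt_lt_R0. apply Rdiv_lt_0_compat; exact W.
    + intros x. rewrite jacobiP_0. ring.
  - intros f Hf. rewrite fhat_eq by assumption. f_equal. apply wint_ext.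
    intros x. rewrite jacobiP_0. ring.
Qed.

Lemma fhat_lin (a b c : R) (f g : R -> R) (n : nat) : -1/2 <= a -> -1/2 <= b ->
  is_poly f -> is_poly g ->
  fhat a b (fun x => f x + c * g x) n = fhat a b f n + c * fhat a b g n.
Proof.
  intros Ha Hb Hf Hg. pose proof (jacobiP_is_poly a b n).
  rewrite !fhat_eq; auto; [|apply is_poly_lin; assumption].
  rewrite (wint_ext _ _ _ (fun x => f x * jacobiP a b n x + c * (g x * jacobiP a b n x)))
    by (intros; ring).
  rewrite wint_lin by (auto; apply is_poly_mult; assumption). ring.
Qed.

Lemma fhat_high (a b : R) (f : R -> R) (d n : nat) : -1/2 <= a -> -1/2 <= b ->
  poly_deg_le f d -> (d < n)%nat -> fhat a b f n = 0.
Proof.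
  intros Ha Hb Hf Hd. rewrite fhat_eq; auto; [|exists d; exact Hf].
  rewrite (wint_ext _ _ _ (fun x => jacobiP a b n x * f x)) by (intros; ring).
  rewrite (jacobiP_orthogonal a b n d) by assumption. ring.
Qed.

(** For fixed n, a coefficient is continuous in the sup norm, with one constant for all polynomials;
    this makes strict sign conditions on it stable. *)
Lemma fhat_bound (a b : R) (n : nat) : -1/2 <= a -> -1/2 <= b ->
  exists K, 0 < K /\ forall f e, is_poly f -> 0 <= e ->
    (forall x, -1 <= x <= 1 -> Rabs (f x) <= e) -> Rabs (fhat a b f n) <= K * e.
Proof.
  intros Ha Hb. pose proof (wint_one_pos a b Ha Hb) as W.
  destruct (poly_bounded _ (jacobiP_is_poly a b n)) as [M [HM B]].
  set (k := jacobi_scale a b n).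
  exists ((Rabs k + 1) * (M * wint a b (fun _ => 1))).
  pose proof (Rabs_pos k). split; [repeat apply Rmult_lt_0_compat; lra|].
  intros f e Hf He H'. rewrite fhat_eq by assumption. fold k. rewrite Rabs_mult, Rmult_assoc.
  apply Rmult_le_compat; [apply Rabs_pos|apply Rabs_pos|lra|].
  assert (P : is_poly (fun x => f x * jacobiP a b n x))
    by (apply is_poly_mult; [exact Hf|apply jacobiP_is_poly]).
  assert (Bd : forall x, -1 < x < 1 -> Rabs (f x * jacobiP a b n x) <= M * e).
  { intros x Hx. rewrite Rabs_mult, Rmult_comm.
    apply Rmult_le_compat; try apply Rabs_pos; [apply B|apply H']; lra. }
  replace (M * wint a b (fun _ => 1) * e) with ((M * e) * wint a b (fun _ => 1)) by ring.
  apply Rabs_le. split.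
  - replace (- (M * e * wint a b (fun _ => 1))) with ((- (M * e)) * wint a b (fun _ => 1)) by ring.
    rewrite <- wint_scal by (auto; apply is_poly_const).
    apply wint_le; auto; [apply is_poly_scal, is_poly_const|].
    intros x Hx. specialize (Bd x Hx). apply Rabs_le_between in Bd. lra.
  - rewrite <- wint_scal by (auto; apply is_poly_const).
    apply wint_le; auto; [apply is_poly_scal, is_poly_const|].
    intros x Hx. specialize (Bd x Hx). apply Rabs_le_between in Bd. lra.
Qed.

(** Completeness provides suprema, so the infimum is found by reflecting [E]; its existence then
    validates the choice made in [Rinf]. *)
Lemma Rinf_spec (E : R -> Prop) : (exists x, E x) -> (forall x, E x -> 0 <= x) ->
  is_glb E (Rinf E).
Proof.
  intros [x0 H0] Hb. unfold Rinf. apply epsilon_spec.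
  destruct (completeness (fun y => E (- y))) as [m [U L]].
  - exists 0. intros y Hy. specialize (Hb _ Hy). lra.
  - exists (- x0). rewrite Ropp_involutive. exact H0.
  - exists (- m). split.
    + intros x Hx. assert (- x <= m); [|lra]. apply U. rewrite Ropp_involutive. exact Hx.
    + intros m' Hm'. assert (m <= - m'); [|lra]. apply L. intros y Hy. specialize (Hm' _ Hy). lra.
Qed.

Lemma rf_spec (f : R -> R) :
  is_glb (fun r => 0 < r <= 2 /\ forall x, -1 <= x < 1 - r -> 0 <= f x) (rf f).
Proof.
  apply Rinf_spec.
  - exists 2. split; [lra|]. intros x Hx. lra.
  - intros r Hr. lra.
Qed.

(** The infimum itself satisfies the sign condition because the interval is open on the right: f(x)
    < 0 forces every admissible radius, hence [rf f], to be at least 1 - x. *)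
Lemma rf_nonneg_before (f : R -> R) (r : R) : rf f <= r ->
  forall x, -1 <= x < 1 - r -> 0 <= f x.
Proof.
  intros H x Hx. apply Rnot_lt_le. intro N. destruct (rf_spec f) as [_ G].
  assert (1 - x <= rf f); [|lra]. apply G. intros r' [Hr' P].
  apply Rnot_lt_le. intro. assert (0 <= f x) by (apply P; lra). lra.
Qed.

Lemma supI_ge (g : R -> R) (x : R) : is_poly g -> inI x -> Rabs (g x) <= supI g.
Proof.
  intros Hg Hx.
  assert (L : is_lub (fun y => exists x, inI x /\ y = Rabs (g x)) (supI g)).
  { unfold supI, Rsup. apply epsilon_spec.
    destruct (completeness (fun y => exists x, inI x /\ y = Rabs (g x))) as [m Hm].
    - destruct (poly_bounded g Hg) as [M [_ B]]. exists M. intros y [t [Ht ->]]. apply B. exact Ht.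
    - exists (Rabs (g x)), x. split; [exact Hx|reflexivity].
    - exists m. exact Hm. }
  apply (proj1 L). exists x. split; [exact Hx|reflexivity].
Qed.

Lemma supI_zero (g : R -> R) : (forall x, g x = 0) -> supI g = 0.
Proof.
  intros H.
  assert (L0 : is_lub (fun y => exists x, inI x /\ y = Rabs (g x)) 0).
  { split.
    - intros y [t [_ ->]]. rewrite H, Rabs_R0. lra.
    - intros m Hm. apply Hm. exists 0. split; [unfold inI; lra|]. rewrite H, Rabs_R0. reflexivity. }
  assert (L : is_lub (fun y => exists x, inI x /\ y = Rabs (g x)) (supI g)).
  { unfold supI, Rsup. apply epsilon_spec. exists 0. exact L0. }
  apply Rle_antisym; [apply (proj2 L), (proj1 L0)|apply (proj2 L0), (proj1 L)].
Qed.

Lemma distray_spec (f h : R -> R) : is_poly f -> is_poly h ->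
  is_glb (fun y => exists c, 0 < c /\ y = supI (fun x => f x - c * h x)) (distray f h).
Proof.
  intros Hf Hh. apply Rinf_spec.
  - exists (supI (fun x => f x - 1 * h x)), 1. split; [lra|reflexivity].
  - intros y [c [Hc ->]]. apply Rle_trans with (Rabs (f 0 - c * h 0)); [apply Rabs_pos|].
    apply (supI_ge (fun x => f x - c * h x)); [|unfold inI; lra].
    apply (is_poly_ext (fun x => f x + (- c) * h x)); [intros; ring|apply is_poly_lin; assumption].
Qed.

Lemma distray_lt (f h : R -> R) (d : R) : is_poly f -> is_poly h -> distray f h < d ->
  exists c, 0 < c /\ forall x, inI x -> Rabs (f x + (- c) * h x) <= d.
Proof.
  intros Hf Hh H. destruct (distray_spec f h Hf Hh) as [_ G].
  apply NNPP. intro N. assert (d <= distray f h); [|lra]. apply G.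
  intros y [c [Hc ->]]. apply Rnot_lt_le. intro L. apply N. exists c. split; [exact Hc|].
  intros x Hx. apply Rle_trans with (supI (fun t => f t - c * h t)); [|lra].
  replace (f x + - c * h x) with (f x - c * h x) by ring.
  apply (supI_ge (fun t => f t - c * h t)); [|exact Hx].
  apply (is_poly_ext (fun t => f t + (- c) * h t)); [intros; ring|apply is_poly_lin; assumption].
Qed.

(** Used contrapositively: a positive distance excludes competitors on the ray of [f]. *)
Lemma distray_proportional (f h : R -> R) (c : R) : is_poly f -> is_poly h -> 0 < c ->
  (forall x, h x = c * f x) -> distray f h <= 0.
Proof.
  intros Hf Hh Hc E. apply (proj1 (distray_spec f h Hf Hh)).
  exists (/ c). split; [apply Rinv_0_lt_compat; exact Hc|]. symmetry. apply supI_zero.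
  intros x. rewrite E. field. lra.
Qed.

Lemma kf_spec (s a b : R) (f : R -> R) : Bs s a b f ->
  kgood s a b f (kf s a b f) /\ forall k, kgood s a b f k -> (kf s a b f <= k)%nat.
Proof.
  intros [_ [_ [[N HN] _]]]. unfold kf. apply epsilon_spec.
  destruct (dec_inh_nat_subset_has_unique_least_element (kgood s a b f)) as [k [Hk _]].
  - intros n. apply classic.
  - exists (S N). split; [lia|]. intros n Hn. apply HN. lia.
  - exists k. exact Hk.
Qed.

(* The coefficient just below [kf s a b f] is strictly of the wrong
   sign, and stays so under a small perturbation. *)
Lemma kf_lower_semicontinuous (s a b : R) (f : R -> R) : -1/2 <= a -> -1/2 <= b -> is_poly f ->
  Bs s a b f -> exists d, 0 < d /\ forall h c, is_poly h -> Bs s a b h -> 0 < c ->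
    (forall x, inI x -> Rabs (f x + (- c) * h x) <= d) -> (kf s a b f <= kf s a b h)%nat.
Proof.
  intros Ha Hb Hf Bf. destruct (kf_spec s a b f Bf) as [[K1 Kg] Kmin].
  set (k := kf s a b f) in *.
  (* For k = 1 there is no coefficient of wrong sign to follow, but [kgood] already demands an index
     of at least 1. *)
  destruct (Nat.eq_dec k 1) as [E1|N1].
  { exists 1. split; [lra|]. intros h c _ Bh _ _. rewrite E1. apply (kf_spec s a b h Bh). }
  set (n := (k - 1)%nat).
  assert (Neg : s * fhat a b f n < 0).
  { apply Rnot_le_lt. intro L. assert (kgood s a b f n).
    - split; [unfold n; lia|]. intros i Hi. destruct (Nat.eq_dec i n) as [->|]; [exact L|].
      apply Kg. unfold n in *. lia.
    - apply Kmin in H. unfold n in H. lia. }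
  destruct (fhat_bound a b n Ha Hb) as [K [HK B]].
  pose proof (Rabs_pos s).
  (* The added 1 keeps the denominator positive and makes the possible change |s| K d strictly
     smaller than the size of the negative coefficient. *)
  set (d := - (s * fhat a b f n) / (K * (Rabs s + 1))).
  assert (HD : 0 < K * (Rabs s + 1)) by (apply Rmult_lt_0_compat; lra).
  assert (Hd : 0 < d) by (apply Rdiv_lt_0_compat; lra).
  exists d. split; [exact Hd|]. intros h c Hh Bh Hc Cl.
  destruct (kf_spec s a b h Bh) as [[L1 Lg] _].
  destruct (Nat.le_gt_cases k (kf s a b h)) as [|Lt]; [assumption|exfalso].
  assert (P : 0 <= s * fhat a b h n) by (apply Lg; unfold n; lia).
  assert (Q : Rabs (fhat a b (fun x => f x + - c * h x) n) <= K * d).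
  { apply B; [apply is_poly_lin; assumption|lra|exact Cl]. }
  rewrite fhat_lin in Q by assumption.
  assert (Q' : Rabs (s * (fhat a b f n + - c * fhat a b h n)) <= Rabs s * (K * d)).
  { rewrite Rabs_mult. apply Rmult_le_compat_l; assumption. }
  assert (Kd : (Rabs s + 1) * (K * d) = - (s * fhat a b f n)) by (unfold d; field; lra).
  apply Rabs_le_between in Q'.
  assert (0 < K * d) by (apply Rmult_lt_0_compat; lra).
  assert (0 <= c * (s * fhat a b h n)) by (apply Rmult_le_pos; lra).
  nra.
Qed.

(** The argument shared by [P] and [Q]. If [rf h] did not exceed [rf f], then [h] would be
    nonnegative on [-1, x1), hence a multiple of [f], hence at distance zero. So the radius strictly
    increases while [kf] does not decrease. *)
Lemma locally_opt_of_extremal (s a b x1 x0 : R) (f : R -> R) : -1/2 <= a -> -1/2 <= b ->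
  -1 <= x1 < 1 -> is_poly f -> B0s s a b f ->
  (forall x, -1 <= x < x1 -> 0 <= f x) -> -1 <= x0 < x1 -> f x0 <> 0 ->
  (forall h, is_poly h -> h 1 = 0 -> wint a b h <= 0 -> deg_le h f ->
    (forall x, -1 <= x < x1 -> 0 <= h x) -> exists c, forall x, h x = c * f x) ->
  locally_opt s a b f.
Proof.
  intros Ha Hb Hx1 Hf Bf Pos Hx0 N0 Ext.
  split; [exact Hf|]. split; [exact Bf|].
  destruct (kf_lower_semicontinuous s a b f Ha Hb Hf (proj1 Bf)) as [d [Hd LS]].
  assert (F0 : 0 < f x0) by (specialize (Pos x0 Hx0); lra).
  (* The bound f(x0) / 2 excludes h(x0) = 0: it makes the proportionality factor positive, as a ray
     requires, and rules out the zero competitor. *)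
  exists (Rmin d (f x0 / 2)). split; [apply Rmin_pos; lra|].
  intros h Hh Bh Dh [D0 D1].
  pose proof (Rmin_l d (f x0 / 2)). pose proof (Rmin_r d (f x0 / 2)).
  destruct (distray_lt f h (Rmin d (f x0 / 2)) Hf Hh D1) as [c [Hc Cl]].
  assert (KK : (kf s a b f <= kf s a b h)%nat).
  { apply (LS h c); auto; [exact (proj1 Bh)|].
    intros x Hx. specialize (Cl x Hx). lra. }
  assert (Rf : rf f <= 1 - x1).
  { apply (proj1 (rf_spec f)). split; [lra|]. intros x Hx. apply Pos. lra. }
  assert (R0 : 0 <= rf f).
  { apply (proj2 (rf_spec f)). intros r Hr. lra. }
  assert (RR : rf f < rf h).
  { apply Rnot_le_lt. intro L.
    destruct (Ext h Hh) as [e He].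
    - apply Bh.
    - destruct (fhat_0 a b Ha Hb) as [K [HK F]]. destruct Bh as [[_ [B0 _]] _].
      rewrite F in B0 by exact Hh. apply Rnot_lt_le. intro. assert (0 < K * wint a b h); [|lra].
      apply Rmult_lt_0_compat; assumption.
    - exact Dh.
    - intros x Hx. apply (rf_nonneg_before h (1 - x1)); lra.
    - assert (h x0 <> 0).
      { intro Z. assert (Ix : inI x0) by (unfold inI; lra). specialize (Cl x0 Ix).
        rewrite Z, Rmult_0_r, Rplus_0_r, Rabs_right in Cl by lra. lra. }
      assert (Hp : 0 <= h x0) by (apply (rf_nonneg_before h (1 - x1)); lra).
      assert (0 < e) by (rewrite He in *; nra).
      pose proof (distray_proportional f h e Hf Hh H2 He). lra. }
  destruct (kf_spec s a b h (proj1 Bh)) as [[L1 _] _].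
  apply Rle_lt_trans with (rf f * INR (kf s a b h) ^ 2).
  - apply Rmult_le_compat_l; [exact R0|]. apply pow_incr. split; [apply pos_INR|].
    apply le_INR. exact KK.
  - apply Rmult_lt_compat_r; [|exact RR]. apply pow_lt. apply lt_0_INR. lia.
Qed.

(** * Extremality of P and Q *)

Lemma jacobi_p_nodes (a b : R) (k : nat) (x1 : R) : -1/2 <= a -> -1/2 <= b ->
  largest_zero a b (S k) x1 ->
  exists l1 l2 K, let l := l1 ++ x1 :: l2 in
    NoDup l /\ (forall z, In z l -> -1 < z < 1) /\ length l = S k /\
    (forall z, In z l -> z <= x1) /\ K <> 0 /\
    (forall x, jacobi_p a b (S k) x = K * lprod l x) /\
    (forall q, poly_deg_le q k -> wint a b (fun x => lprod l x * q x) = 0).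
Proof.
  intros Ha Hb [Z1 Zmax].
  set (c := / sqrt (wmean a b (fun y => jacobiP a b (S k) y ^ 2))).
  assert (J : forall x, jacobi_p a b (S k) x = c * jacobiP a b (S k) x)
    by (intros; unfold jacobi_p, c, Rdiv; ring).
  (* A largest zero exists only if the function is not identically zero; this yields both a nonzero
     normalizing factor and a point where [jacobiP] does not vanish. *)
  assert (N : jacobi_p a b (S k) (x1 + 1) <> 0) by (intro Z; apply Zmax in Z; lra).
  rewrite J in N.
  assert (Nc : c <> 0) by (intro Z; apply N; rewrite Z; ring).
  destruct (jacobiP_factor a b (S k) (x1 + 1) Ha Hb) as [l [K [ND [Hl [Len [NK E]]]]]].
  { intro Z. apply N. rewrite Z. ring. }
  assert (I1 : In x1 l).
  { apply lprod_root. rewrite J, E in Z1. apply Rmult_integral in Z1.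
    destruct Z1 as [Z|Z]; [contradiction|]. apply Rmult_integral in Z.
    destruct Z as [Z|Z]; [contradiction|exact Z]. }
  destruct (in_split x1 l I1) as [l1 [l2 ->]].
  exists l1, l2, (c * K). cbv zeta. split; [exact ND|]. split; [exact Hl|]. split; [exact Len|].
  split; [|split; [|split]].
  - intros z Iz. apply Zmax. rewrite J, E. apply lprod_root in Iz. rewrite Iz. ring.
  - apply Rmult_integral_contrapositive. split; assumption.
  - intros x. rewrite J, E. ring.
  - intros q Hq. pose proof (jacobiP_orthogonal a b (S k) k q Ha Hb Hq ltac:(lia)) as O.
    rewrite (wint_ext a b _ (fun x => K * (lprod (l1 ++ x1 :: l2) x * q x))) in O
      by (intros; rewrite E; ring).
    rewrite wint_scal in O; auto.
    + apply Rmult_integral in O. destruct O; [contradiction|assumption].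
    + apply is_poly_mult; [apply lprod_is_poly|exists k; exact Hq].
Qed.

(** [P] and [Q] are specified by an identity multiplied by x1 - x, which says nothing at [x1];
    continuity supplies the value there. *)
Lemma poly_cancel_linear (f g : R -> R) (z : R) : is_poly f -> is_poly g ->
  (forall x, f x * (z - x) = g x * (z - x)) -> forall x, f x = g x.
Proof.
  intros Hf Hg H x.
  assert (P : forall y, y <> z -> f y + (-1) * g y = 0).
  { intros y N. apply (Rmult_eq_reg_r (z - y)); [|lra]. specialize (H y). lra. }
  destruct (Req_dec x z) as [->|N]; [|specialize (P x N); lra].
  assert (f z + (-1) * g z = 0); [|lra].
  apply (continuous_eq_punctured (fun y => f y + (-1) * g y) z 1); [|lra|].
  - apply is_poly_continuous, is_poly_lin; assumption.
  - intros y _ N. apply P. exact N.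
Qed.

(** Nonnegativity is assumed only to the left of [x1], yet quadrature also needs the sign at the
    node [x1]; it passes to the limit. *)
Lemma poly_nonneg_endpoint (g : R -> R) (x1 : R) : is_poly g -> -1 < x1 ->
  (forall x, -1 < x < x1 -> 0 <= g x) -> 0 <= g x1.
Proof.
  intros Hg H1 H. apply Rnot_lt_le. intro N.
  destruct (continuous_neighbourhood g x1 (is_poly_continuous g x1 Hg) (- g x1)) as [d [Hd P]];
    [lra|].
  set (t := Rmin d (x1 + 1) / 2). pose proof (Rmin_l d (x1 + 1)). pose proof (Rmin_r d (x1 + 1)).
  assert (0 < Rmin d (x1 + 1)) by (apply Rmin_pos; lra).
  assert (A : Rabs (x1 - t - x1) < d) by (apply Rabs_def1; unfold t; lra).
  apply P, Rabs_def2 in A. assert (0 <= g (x1 - t)) by (apply H; unfold t; lra). lra.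
Qed.

(** All nodes are interior, so the product is nonzero at -1 and, by continuity, slightly to its
    right. This supplies a point where the extremal polynomial is strictly positive. *)
Lemma lprod_nonzero_left (l : list R) (x1 : R) : (forall z, In z l -> -1 < z < 1) -> -1 < x1 ->
  exists x0, -1 < x0 < x1 /\ lprod l x0 <> 0.
Proof.
  intros Hl H1.
  assert (N : lprod l (-1) <> 0) by (intro Z; apply lprod_root, Hl in Z; lra).
  pose proof (Rabs_pos_lt _ N) as N'.
  destruct (continuous_neighbourhood (lprod l) (-1)
    (is_poly_continuous _ _ (lprod_is_poly l)) _ N') as [d [Hd P]].
  set (t := Rmin d (x1 + 1) / 2). pose proof (Rmin_l d (x1 + 1)). pose proof (Rmin_r d (x1 + 1)).
  assert (0 < Rmin d (x1 + 1)) by (apply Rmin_pos; lra).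
  exists (-1 + t). split; [unfold t; lra|]. intro Z.
  assert (A : Rabs (-1 + t - -1) < d) by (apply Rabs_def1; unfold t; lra).
  apply P in A. rewrite Z, Rminus_0_l, Rabs_Ropp in A. lra.
Qed.

(** A polynomial has only finitely many nonzero coefficients, so the eventual sign condition holds
    with zeros. *)
Lemma B0s_of_poly (s a b : R) (f : R -> R) : -1/2 <= a -> -1/2 <= b -> is_poly f ->
  wint a b f = 0 -> f 1 = 0 -> B0s s a b f.
Proof.
  intros Ha Hb Hf W F1. split; [|exact F1]. split; [|split; [|split]].
  - intros x _ eps He.
    destruct (continuous_neighbourhood f x (is_poly_continuous f x Hf) eps He) as [d [Hd P]].
    exists d. split; [exact Hd|]. intros y _ Hy. apply P. exact Hy.
  - destruct (fhat_0 a b Ha Hb) as [K [_ F]]. rewrite F, W by exact Hf. lra.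
  - destruct Hf as [d Hd]. exists (S d). intros n Hn.
    rewrite (fhat_high a b f d n) by (auto; lia). lra.
  - rewrite F1. lra.
Qed.

(* Radau case: the quadrature nodes are the zeros together with the endpoint 1. *)
Lemma radau_locally_opt (alpha beta s x1 : R) (m : nat) (P : R -> R) :
  -1/2 <= alpha -> -1/2 <= beta -> (1 <= m)%nat ->
  largest_zero (alpha + 1) beta m x1 -> is_poly P ->
  (forall x, P x * (x1 - x) = (1 - x) * (jacobi_p (alpha + 1) beta m x) ^ 2) ->
  locally_opt s alpha beta P.
Proof.
  intros Ha Hb Hm Hz PP HP. destruct m as [|k]; [lia|].
  destruct (jacobi_p_nodes (alpha + 1) beta k x1) as
    [l1 [l2 [K [ND [Hl [Len [Hmax [NK [E Orth]]]]]]]]]; [lra|lra|exact Hz|].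
  set (l := l1 ++ x1 :: l2) in *. set (l' := l1 ++ l2).
  assert (I1 : In x1 l) by (apply in_elt).
  assert (Hx1 : -1 < x1 < 1) by (apply Hl; exact I1).
  assert (El : forall x, lprod l x = (x - x1) * lprod l' x) by (intros; apply lprod_app_cons).
  assert (Len' : length l' = k).
  { unfold l, l' in *. rewrite length_app in *. simpl in Len. lia. }
  assert (Dg : poly_deg_le (fun x => K ^ 2 * ((x1 - x) * lprod l' x ^ 2)) (k + length l)).
  { apply poly_deg_le_scal.
    apply (poly_deg_le_weaken _ (1 + 2 * length l')); [|lia].
    apply (poly_deg_le_mult (fun x => x1 - x) (fun x => lprod l' x ^ 2)).
    - apply (poly_deg_le_ext (fun x => x1 + (-1) * x)); [intros; ring|apply poly_deg_le_affine].
    - apply poly_deg_le_pow, lprod_deg. }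
  assert (DR : poly_deg_le (fun x => (1 - x) * (K ^ 2 * ((x1 - x) * lprod l' x ^ 2)))
    (S (k + length l))).
  { apply (poly_deg_le_mult (fun x => 1 - x) _ 1 (k + length l)); [|exact Dg].
    apply (poly_deg_le_ext (fun x => 1 + (-1) * x)); [intros; ring|apply poly_deg_le_affine]. }
  assert (PE : forall x, P x = (1 - x) * (K ^ 2 * ((x1 - x) * lprod l' x ^ 2))).
  { apply (poly_cancel_linear _ _ x1 PP); [eexists; exact DR|].
    intros x. rewrite HP, E, El. ring. }
  destruct (lprod_nonzero_left l x1 Hl) as [x0 [Hx0 N0]]; [lra|].
  apply (locally_opt_of_extremal s alpha beta x1 x0); auto; try lra.
  - apply B0s_of_poly; auto; [|rewrite PE; ring].
    rewrite (wint_ext _ _ _ _ PE). rewrite <- wint_shiftl; auto; [|eexists; exact Dg].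
    (* One copy of the node polynomial is split off; the cofactor has degree k, within reach of
       orthogonality. The sign comes from x1 - x against x - x1. *)
    rewrite <- (Orth (fun x => - K ^ 2 * lprod l' x)).
    + apply wint_ext. intros x. rewrite El. ring.
    + apply poly_deg_le_scal. rewrite <- Len' at 1. apply lprod_deg.
  - intros x Hx. rewrite PE. apply Rmult_le_pos; [lra|].
    apply Rmult_le_pos; [apply pow2_ge_0|]. apply Rmult_le_pos; [lra|apply pow2_ge_0].
  - rewrite PE. rewrite El in N0.
    assert (lprod l' x0 <> 0) by (intro Z; apply N0; rewrite Z; ring).
    apply Rmult_integral_contrapositive_currified; [lra|].
    apply Rmult_integral_contrapositive_currified; [apply pow_nonzero; assumption|].
    apply Rmult_integral_contrapositive_currified; [lra|apply pow_nonzero; assumption].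
  - intros h Hh h1 Wh Dh Hpos.
    assert (Hd : poly_deg_le h (S (k + length l))).
    { apply Dh. apply (poly_deg_le_ext _ _ _ (fun x => eq_sym (PE x))). exact DR. }
    destruct (poly_div_root h _ 1 Hd) as [g0 [Hg0 Eh]].
    (* The sign turns the factor x - 1 of the division into 1 - x, which is positive inside the
       interval and can join the weight. *)
    set (g := fun x => (-1) * g0 x).
    assert (Hg : poly_deg_le g (k + length l)) by (apply poly_deg_le_scal; exact Hg0).
    assert (Pg : is_poly g) by (eexists; exact Hg).
    assert (Eg : forall x, h x = (1 - x) * g x) by (intros x; rewrite Eh, h1; unfold g; ring).
    assert (Wg : wint (alpha + 1) beta g <= 0).
    { rewrite wint_shiftl by assumption. rewrite <- (wint_ext _ _ _ _ Eg). exact Wh. }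
    assert (Gpos : forall x, -1 < x < x1 -> 0 <= g x).
    { intros x Hx. assert (H : 0 <= h x) by (apply Hpos; lra). rewrite Eg in H.
      apply (Rmult_le_reg_l (1 - x)); lra. }
    destruct (gauss_nodes_vanish (alpha + 1) beta l k g) as [_ V]; auto; try lra.
    { intros z Iz. destruct (Req_dec z x1) as [->|Nz].
      - apply poly_nonneg_endpoint; auto; lra.
      - apply Gpos. specialize (Hmax z Iz). specialize (Hl z Iz). lra. }
    destruct (extremal_form l k x1 g) as [c Hc]; auto.
    exists (c / K ^ 2). apply (poly_cancel_linear _ _ x1 Hh); [apply is_poly_scal; exact PP|].
    intros x. transitivity (c / K ^ 2 * (P x * (x1 - x))); [|ring].
    rewrite Eg, HP, E.
    transitivity ((1 - x) * ((x1 - x) * g x)); [ring|]. rewrite Hc. field. exact NK.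
Qed.

(* Lobatto case: the quadrature nodes are the zeros together with both endpoints. *)
Lemma lobatto_locally_opt (alpha beta s x1 : R) (m : nat) (Q : R -> R) :
  -1/2 <= alpha -> -1/2 <= beta -> (1 <= m)%nat ->
  largest_zero (alpha + 1) (beta + 1) m x1 -> is_poly Q ->
  (forall x, Q x * (x1 - x) = (1 - x ^ 2) * (jacobi_p (alpha + 1) (beta + 1) m x) ^ 2) ->
  locally_opt s alpha beta Q.
Proof.
  intros Ha Hb Hm Hz PQ HQ. destruct m as [|k]; [lia|].
  destruct (jacobi_p_nodes (alpha + 1) (beta + 1) k x1) as
    [l1 [l2 [K [ND [Hl [Len [Hmax [NK [E Orth]]]]]]]]]; [lra|lra|exact Hz|].
  set (l := l1 ++ x1 :: l2) in *. set (l' := l1 ++ l2).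
  assert (I1 : In x1 l) by (apply in_elt).
  assert (Hx1 : -1 < x1 < 1) by (apply Hl; exact I1).
  assert (El : forall x, lprod l x = (x - x1) * lprod l' x) by (intros; apply lprod_app_cons).
  assert (Len' : length l' = k).
  { unfold l, l' in *. rewrite length_app in *. simpl in Len. lia. }
  assert (D1m : poly_deg_le (fun x => 1 - x) 1).
  { apply (poly_deg_le_ext (fun x => 1 + (-1) * x)); [intros; ring|apply poly_deg_le_affine]. }
  assert (D1p : poly_deg_le (fun x => 1 + x) 1).
  { apply (poly_deg_le_ext (fun x => 1 + 1 * x)); [intros; ring|apply poly_deg_le_affine]. }
  set (R0 := fun x => K ^ 2 * ((x1 - x) * lprod l' x ^ 2)).
  assert (Dg : poly_deg_le R0 (k + length l)).
  { apply poly_deg_le_scal.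
    apply (poly_deg_le_weaken _ (1 + 2 * length l')); [|lia].
    apply (poly_deg_le_mult (fun x => x1 - x) (fun x => lprod l' x ^ 2)).
    - apply (poly_deg_le_ext (fun x => x1 + (-1) * x)); [intros; ring|apply poly_deg_le_affine].
    - apply poly_deg_le_pow, lprod_deg. }
  assert (Dg' : poly_deg_le (fun x => (1 + x) * R0 x) (S (k + length l)))
    by exact (poly_deg_le_mult _ _ 1 (k + length l) D1p Dg).
  assert (DR : poly_deg_le (fun x => (1 - x) * ((1 + x) * R0 x)) (S (S (k + length l))))
    by exact (poly_deg_le_mult _ _ 1 (S (k + length l)) D1m Dg').
  assert (QE : forall x, Q x = (1 - x) * ((1 + x) * R0 x)).
  { apply (poly_cancel_linear _ _ x1 PQ); [eexists; exact DR|].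
    intros x. rewrite HQ, E, El. unfold R0. ring. }
  destruct (lprod_nonzero_left l x1 Hl) as [x0 [Hx0 N0]]; [lra|].
  apply (locally_opt_of_extremal s alpha beta x1 x0); auto; try lra.
  - apply B0s_of_poly; auto; [|rewrite QE; ring].
    rewrite (wint_ext _ _ _ _ QE). rewrite <- wint_shiftl; auto; [|eexists; exact Dg'].
    rewrite <- wint_shiftr; try lra; [|eexists; exact Dg].
    rewrite <- (Orth (fun x => - K ^ 2 * lprod l' x)).
    + apply wint_ext. intros x. rewrite El. unfold R0. ring.
    + apply poly_deg_le_scal. rewrite <- Len' at 1. apply lprod_deg.
  - intros x Hx. rewrite QE. unfold R0. apply Rmult_le_pos; [lra|]. apply Rmult_le_pos; [lra|].
    apply Rmult_le_pos; [apply pow2_ge_0|]. apply Rmult_le_pos; [lra|apply pow2_ge_0].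
  - rewrite QE. unfold R0. rewrite El in N0.
    assert (lprod l' x0 <> 0) by (intro Z; apply N0; rewrite Z; ring).
    apply Rmult_integral_contrapositive_currified; [lra|].
    apply Rmult_integral_contrapositive_currified; [lra|].
    apply Rmult_integral_contrapositive_currified; [apply pow_nonzero; assumption|].
    apply Rmult_integral_contrapositive_currified; [lra|apply pow_nonzero; assumption].
  - intros h Hh h1 Wh Dh Hpos.
    assert (Hd : poly_deg_le h (S (S (k + length l)))).
    { apply Dh. apply (poly_deg_le_ext _ _ _ (fun x => eq_sym (QE x))). exact DR. }
    destruct (poly_div_root h _ 1 Hd) as [g0 [Hg0 Eh]].
    set (g := fun x => (-1) * g0 x).
    assert (Hg : poly_deg_le g (S (k + length l))) by (apply poly_deg_le_scal; exact Hg0).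
    assert (Pg : is_poly g) by (eexists; exact Hg).
    assert (Eg : forall x, h x = (1 - x) * g x) by (intros x; rewrite Eh, h1; unfold g; ring).
    assert (Wg : wint (alpha + 1) beta g <= 0).
    { rewrite wint_shiftl by assumption. rewrite <- (wint_ext _ _ _ _ Eg). exact Wh. }
    assert (Gpos : forall x, -1 <= x < x1 -> 0 <= g x).
    { intros x Hx. assert (H : 0 <= h x) by (apply Hpos; lra). rewrite Eg in H.
      apply (Rmult_le_reg_l (1 - x)); lra. }
    set (pi1 := lprod l (-1)).
    assert (Npi : pi1 <> 0) by (intro Z; apply lprod_root, Hl in Z; lra).
    (* Plays the part of the Lobatto weight at -1: equal to 1 there and 0 at all interior nodes. Its
       degree 2k + 2 is exactly the bound available for [g]. *)
    set (w := fun x => (/ pi1 * lprod l x) ^ 2).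
    assert (Dw : poly_deg_le w (S (k + length l))).
    { apply (poly_deg_le_weaken _ (2 * length l)); [|lia].
      apply (poly_deg_le_pow (fun x => / pi1 * lprod l x)). apply poly_deg_le_scal, lprod_deg. }
    assert (Pw : is_poly w) by (eexists; exact Dw).
    assert (w1 : w (-1) = 1) by (unfold w; fold pi1; field; exact Npi).
    assert (wz : forall z, In z l -> w z = 0).
    { intros z Iz. apply lprod_root in Iz. unfold w. rewrite Iz. ring. }
    assert (Ww : 0 < wint (alpha + 1) beta w).
    { apply (wint_gt0 _ _ w x0); try lra; auto; [intros; apply pow2_ge_0|].
      unfold w. apply pow_nonzero, Rmult_integral_contrapositive_currified;
        [apply Rinv_neq_0_compat|]; assumption. }
    (* Removing the value at -1 produces a factor 1 + x, which moves into the weight and leaves a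
       Gauss problem for [g1] with both exponents raised. *)
    destruct (poly_div_root (fun x => g x + (- g (-1)) * w x) (k + length l) (-1))
      as [g1 [Hg1 Eg1]].
    { apply poly_deg_le_plus; [exact Hg|apply poly_deg_le_scal; exact Dw]. }
    assert (Pg1 : is_poly g1) by (eexists; exact Hg1).
    assert (Eg' : forall x, g x = (1 + x) * g1 x + g (-1) * w x).
    { intros x. specialize (Eg1 x). simpl in Eg1. rewrite w1 in Eg1.
      replace (x - -1) with (1 + x) in Eg1 by ring. lra. }
    assert (W1 : wint (alpha + 1) beta g
      = wint (alpha + 1) (beta + 1) g1 + g (-1) * wint (alpha + 1) beta w).
    { rewrite (wint_ext _ _ _ _ Eg').
      rewrite (wint_lin _ _ _ (fun x => (1 + x) * g1 x) w); try lra; auto.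
      - rewrite wint_shiftr by (auto; lra). reflexivity.
      - apply is_poly_mult; [apply is_poly_one_plus|exact Pg1]. }
    assert (G1 : 0 <= g (-1)) by (apply Gpos; lra).
    assert (0 <= g (-1) * wint (alpha + 1) beta w) by (apply Rmult_le_pos; lra).
    destruct (gauss_nodes_vanish (alpha + 1) (beta + 1) l k g1) as [W0 V]; auto; try lra.
    { intros z Iz. assert (Zz := Hl z Iz). assert (0 <= g z).
      - destruct (Req_dec z x1) as [->|Nz].
        + apply poly_nonneg_endpoint; auto; try lra. intros; apply Gpos; lra.
        + apply Gpos. specialize (Hmax z Iz). lra.
      - rewrite Eg', wz in H0 by exact Iz. apply (Rmult_le_reg_l (1 + z)); lra. }
    (* The integral of [g] is at most 0 and splits into two nonnegative parts, so both vanish. *)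
    assert (Z1 : g (-1) = 0).
    { apply (Rmult_eq_reg_r (wint (alpha + 1) beta w)); lra. }
    destruct (extremal_form l k x1 g1) as [c Hc]; auto.
    { apply V. lra. }
    { intros x Hx. assert (H' : 0 <= g x) by (apply Gpos; lra).
      rewrite Eg', Z1 in H'. apply (Rmult_le_reg_l (1 + x)); lra. }
    exists (c / K ^ 2). apply (poly_cancel_linear _ _ x1 Hh); [apply is_poly_scal; exact PQ|].
    intros x. transitivity (c / K ^ 2 * (Q x * (x1 - x))); [|ring].
    rewrite Eg, HQ, E, Eg', Z1.
    transitivity ((1 - x) * (1 + x) * ((x1 - x) * g1 x)); [ring|]. rewrite Hc. field. exact NK.
Qed.

Theorem mainTheorem10 :
  forall (alpha beta : R), -1/2 <= beta -> beta <= alpha ->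
  forall s : R, s = 1 \/ s = -1 ->
  (forall (m : nat) (x1 : R) (P : R -> R), (1 <= m)%nat ->
     largest_zero (alpha + 1) beta m x1 ->
     is_poly P ->
     (forall x, P x * (x1 - x) = (1 - x) * (jacobi_p (alpha + 1) beta m x) ^ 2) ->
     locally_opt s alpha beta P) /\
  (forall (m : nat) (x1 : R) (Q : R -> R), (2 <= m)%nat ->
     largest_zero (alpha + 1) (beta + 1) (m - 1) x1 ->
     is_poly Q ->
     (forall x, Q x * (x1 - x) = (1 - x ^ 2) * (jacobi_p (alpha + 1) (beta + 1) (m - 1) x) ^ 2) ->
     locally_opt s alpha beta Q).
Proof.
  intros alpha beta Hb Hab s _. split.
  - intros m x1 P Hm. apply radau_locally_opt; [lra|exact Hb|exact Hm].
  - intros m x1 Q Hm. apply lobatto_locally_opt; [lra|exact Hb|lia].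
Qed.
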